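(* Let $r\ge3$ and let $M$ be the adjacency matrix of the graph $G_r$. Let $K$ be the set of vertices of any single one of the three orbits $\{a_i\}$, $\{b_i\}$, $\{c_i\}$ (for instance the vertices of the central cycle $C_r$), and let $M^K=M+Q\cdot D_K$ for a transcendental real number $Q$. Then $M^K$ exhibits pretty good fractional revival with respect to $K$.
   Context: $G_r$ is the graph obtained from a cycle $C_r$ of order $r$ by attaching a diamond graph (two triangles sharing an edge) along each edge, in a rotationally symmetric way: the vertices are $a_i,b_i,c_i$ for $i\in\mathbb{Z}/r$; the edges are $a_ia_{i+1}$ (the central cycle), $b_ia_i$, $b_ia_{i+1}$, $c_ia_i$ and $c_ib_i$ for all $i\in\mathbb{Z}/r$. The cyclic group of order $r$ acts by $i\mapsto i+1$, with three orbits $\{a_i\}$ (vertices of degree 5), $\{b_i\}$ (degree 3), $\{c_i\}$ (degree 2). $D_K$ is the diagonal matrix with diagonal entries $1$ in $K$ and $0$ elsewhere. A real symmetric matrix $N\in\mathbb{R}^{X\times X}$ exhibits pretty good fractional revival with respect to $K\subset X$ if the closure of $\{\exp(itN)_{K\times K}:t\ge0\}$ contains a unitary $K\times K$ matrix that is not a scalar multiple of the identity (equivalently, that has at least two distinct eigenvalues). Here $A_{K\times K}$ denotes the $K\times K$ submatrix of $A$. *)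

(* Defs.v *)
From HB Require Import structures.
From mathcomp Require Import all_boot all_order all_algebra.
From mathcomp Require Import all_classical all_reals all_analysis.
From mathcomp Require Import complex.

Set Implicit Arguments.
Unset Strict Implicit.
Unset Printing Implicit Defensive.

Import Order.TTheory GRing.Theory Num.Theory.
Import numFieldNormedType.Exports.

Local Open Scope classical_set_scope.
Local Open Scope ring_scope.

(* Matrices indexed by a finite type X are square matrices of size #|X|, whose
   indices are identified with elements of X by enum_val and enum_rank. *)

Definition graph_adjmx (R : pzRingType) (X : finType) (e : rel X) :
    'M[R]_#|X| :=
  \matrix_(i, j) (e (enum_val i) (enum_val j))%:R.

Definition indic_diag_mx (R : pzRingType) (X : finType) (K : {set X}) :
    'M[R]_#|X| :=
  diag_mx (\row_i (enum_val i \in K)%:R).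

Definition principal_submx (T : Type) (X : finType) (K : {set X})
    (A : 'M[T]_#|X|) : 'M[T]_#|K| :=
  let f (i : 'I_#|K|) : 'I_#|X| := enum_rank (enum_val i) in
  mxsub f f A.

Definition expmx (C : numFieldType) (n : nat) (A : 'M[C]_n) : 'M[C]_n :=
  lim (series (fun k : nat => (k`!%:R)^-1 *: A ^+ k) @ \oo).

(* The topology on matrices over R[i] is the one of uniform convergence of the
   entries for the complex modulus.  The library attaches it to a numFieldType,
   not to the bare type of complex numbers, hence this packed version. *)
Definition complexC (R : realType) : numClosedFieldType := R[i].

Definition unitary_evolution (R : realType) (n : nat) (N : 'M[R]_n) (t : R) :
    'M[complexC R]_n :=
  expmx ((0 +i* t)%C *: map_mx (real_complex R) N : 'M[complexC R]_n).

Definition pretty_good_fractional_revival (R : realType) (X : finType)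
    (N : 'M[R]_#|X|) (K : {set X}) : Prop :=
  exists U : 'M[complexC R]_#|K|,
    [/\ closure [set principal_submx K (unitary_evolution N t)
                | t in [set t : R | 0 <= t]] U,
        U \is unitarymx
      & ~~ is_scalar_mx U].

Definition transcendental (R : realType) (x : R) : Prop :=
  ~ algebraicOver (ratr : rat -> R) x.

(* 'I_r is used as Z/r, with ordS as i |-> i + 1 *)
Definition Gr_vertex (r : nat) : finType := ('I_r + 'I_r + 'I_r)%type.
Definition va (r : nat) (i : 'I_r) : Gr_vertex r := inl (inl i).
Definition vb (r : nat) (i : 'I_r) : Gr_vertex r := inl (inr i).
Definition vc (r : nat) (i : 'I_r) : Gr_vertex r := inr i.

Definition Gr_arc (r : nat) (x y : Gr_vertex r) : bool :=
  match x, y with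
  | inl (inl i), inl (inl j) => j == ordS i
  | inl (inr i), inl (inl j) => (j == i) || (j == ordS i)
  | inr i, inl (inl j) => j == i
  | inr i, inl (inr j) => j == i
  | _, _ => false
  end.

Definition Gr_edge (r : nat) : rel (Gr_vertex r) :=
  fun x y => Gr_arc x y || Gr_arc y x.

Definition orbit_a (r : nat) : {set Gr_vertex r} := [set va i | i : 'I_r]%SET.
Definition orbit_b (r : nat) : {set Gr_vertex r} := [set vb i | i : 'I_r]%SET.
Definition orbit_c (r : nat) : {set Gr_vertex r} := [set vc i | i : 'I_r]%SET.

(* Main.v *)
Require Import Defs.
From HB Require Import structures.
From mathcomp Require Import all_boot all_order all_algebra.
From mathcomp Require Import all_classical all_reals all_analysis.
From mathcomp Require Import complex ring lra zify.

(** The rotation [i |-> i + 1] of the graph commutes with the weighted adjacency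
matrix [N], so a unitary matrix [V] diagonalizes both: the [k]-th joint
eigenvector has an eigenvalue [l_k] of [N] and a root of unity [w_k].  Put
[x_k = w_k + 1 / w_k], a real algebraic number between -2 and 2.  Let [W] be the
matrix with the same eigenvectors as [N] and with eigenvalues [exp(i x_k / 2)].
It is a function of the rotation alone, hence commutes with the projection on
the orbit [K], so that its [K x K] block is unitary.  This block is not scalar,
because [exp(i x / 2)] determines [x] between -2 and 2, and the matrix with
eigenvalues [x_k], namely the sum of the rotation and its inverse, is not scalar
on [K].

It remains to approach [W] by [exp(itN)], that is, to find [t >= 0] for which
all the [exp(i t l_k)] are close to the [exp(i x_k / 2)].  Kronecker's theorem
([kronecker]) gives such [t] provided that every integer relation
[sum_k m_k l_k = 0] entails [sum_k m_k x_k = 0].  On a joint eigenspace of the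
rotation, [N] acts by a [3 x 3] matrix of trace [x + Q], whose characteristic
polynomial is [p - Q q] with [p] a cubic and [q] a quadratic over the field of
real algebraic numbers ([block_char_eq], [pencil_char_eq]).  As [p] and [q] are
coprime and [Q] is transcendental, [p - Q q] is irreducible over the field [F]
of rational expressions in [Q] with algebraic coefficients
([pencil_irreducible]).  Hence the normalized trace from a finite extension of
[F] containing the [l_k] sends [l_k] to [(x_k + Q) / 3], and the relation becomes
[sum_k m_k x_k + Q sum_k m_k = 0] ([trace_form_relation],
[pencil_trace_relation]); transcendence of [Q] makes both sums vanish. *)

Set Implicit Arguments.
Unset Strict Implicit.
Unset Printing Implicit Defensive.

Import Order.TTheory GRing.Theory Num.Theory.
Import numFieldNormedType.Exports.

Local Open Scope ring_scope.

(** * Traces of algebraic elements *)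

Lemma coef_mul_monic_subleading (F : nzRingType) (a b : nat) (p q : {poly F}) :
  p \is monic -> size p = a.+2 -> q \is monic -> size q = b.+2 ->
  (p * q)`_(a + b).+1 = p`_a + q`_b.
Proof.
move=> /monicP p1 sp /monicP q1 sq.
have [p' Ep sp'] : exists2 p', p = 'X^(a.+1) + p' & (size p' <= a.+1)%N.
  exists (p - 'X^(a.+1)); first by rewrite addrC subrK.
  apply/leq_sizeP => j; rewrite leq_eqVlt coefB coefXn => /orP[/eqP <-|lt].
    by move: p1; rewrite lead_coefE sp /= => ->; rewrite eqxx subrr.
  by rewrite gtn_eqF // nth_default ?subrr // sp.
have [q' Eq sq'] : exists2 q', q = 'X^(b.+1) + q' & (size q' <= b.+1)%N.
  exists (q - 'X^(b.+1)); first by rewrite addrC subrK.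
  apply/leq_sizeP => j; rewrite leq_eqVlt coefB coefXn => /orP[/eqP <-|lt].
    by move: q1; rewrite lead_coefE sq /= => ->; rewrite eqxx subrr.
  by rewrite gtn_eqF // nth_default ?subrr // sq.
rewrite Ep Eq mulrDl !mulrDr -exprD !coefD !coefXn !coefXnM coefMXn.
have -> : ((a + b).+1 == a.+1 + b.+1)%N = false.
  by rewrite addnS eqSS addSn ltn_eqF.
have -> : ((a + b).+1 < a.+1)%N = false by rewrite ltnS ltnNge leq_addr.
have -> : ((a + b).+1 < b.+1)%N = false by rewrite ltnS ltnNge leq_addl.
rewrite !subSS addnK addKn ltn_eqF // ltn_eqF // !add0r.
rewrite [(p' * q')`_ _]nth_default ?addr0 1?addrC //.
apply: (leq_trans (size_polyMleq _ _)).
by rewrite -subn1 leq_subLR add1n -addnS -addSn leq_add.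
Qed.

(** Over an algebraically closed field, [q] shares a root with the irreducible
polynomial [p], so [p] divides [q]; repeating, [q] is a power of [p].  The
identity compares the sums of the roots of [p] and of [q]. *)
Lemma subleading_coef_same_roots (F : fieldType) (C : closedFieldType)
    (iota : {rmorphism F -> C}) (d n : nat) (p q : {poly F}) :
  irreducible_poly p -> p \is monic -> size p = d.+2 ->
  q \is monic -> size q = n.+2 ->
  (forall z, root (map_poly iota q) z -> root (map_poly iota p) z) ->
  d.+1%:R * q`_n = n.+1%:R * p`_d.
Proof.
move=> p_irr p_mon sp; have [m] := ubnP n.
elim: m n q => // m IHm n q /ltnSE le_nm q_mon sq q_root.
have [z qz] : exists z, root (map_poly iota q) z.
  by apply/closed_rootP; rewrite size_map_poly sq.
have : ~~ coprimep p q.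
  rewrite -(coprimep_map iota); apply/negP => /coprimep_root cop.
  by have := cop _ (q_root _ qz); rewrite (rootP qz) eqxx.
rewrite irreducible_poly_coprime // negbK => /dvdpP[q' Eq].
have q'_mon : q' \is monic by move: q_mon; rewrite Eq monicMr.
have sq' : (size q' + d.+1 = n.+2)%N.
  by rewrite -sq Eq size_monicM // ?monic_neq0 // sp !addnS.
case sn' : (size q') sq' => [|[|n']] Hn.
- by move/eqP: sn'; rewrite size_poly_eq0 (negPf (monic_neq0 q'_mon)).
- have q'1 : q' = 1.
    have c : q' = (q'`_0)%:P by apply: size1_polyC; rewrite sn'.
    by move/monicP: q'_mon; rewrite lead_coefE sn' /= c coefC /= => ->.
  by move: Hn; rewrite add1n => -[<-]; rewrite Eq q'1 mul1r.
move: Hn; rewrite !addSn => -[En]; rewrite -En Eq addnS.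
rewrite coef_mul_monic_subleading // mulrDr (IHm n' q') //.
- by rewrite -!mulrDl -!natrD; congr (_%:R * _); rewrite addSn addnS.
- by apply: leq_trans le_nm; rewrite -En addnS ltnS leq_addr.
- by move=> y q'y; apply: q_root; rewrite Eq rmorphM rootM q'y.
Qed.

(** The eigenvalues of [A] are roots of [p], so its characteristic polynomial is a
power of [p]: up to the normalization by degrees, [A] has the trace of a root
of [p]. *)
Lemma trace_root_irreducible (F : fieldType) (C : closedFieldType)
    (iota : {rmorphism F -> C}) (d n : nat) (p : {poly F}) (A : 'M[F]_n.+1) :
  irreducible_poly p -> p \is monic -> size p = d.+2 -> horner_mx A p = 0 ->
  d.+1%:R * \tr A = - (n.+1%:R * p`_d).
Proof.
move=> p_irr p_mon sp pA.
rewrite -(@subleading_coef_same_roots _ _ iota d n p (char_poly A)) //.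
- by rewrite -{2}[n]/(n.+1.-1) char_poly_trace // mulrN opprK.
- exact: char_poly_monic.
- exact: size_char_poly.
move=> z; rewrite map_char_poly -root_mxminpoly mxminpoly_map.
by apply: root_dvdp; rewrite dvdp_map; exact: mxminpoly_min.
Qed.

Section JointEigenvectors.
Variables (F C : fieldType) (iota : {rmorphism F -> C}).

(** The entries of [v] span over [F] a space stable under multiplication by every
[z i], the matrices [A] being those of these multiplications.  This stands for
a finite extension of [F] containing the [z i]. *)
Definition joint_eigenvector (I : Type) (z : I -> C) (n : nat) (v : 'rV[C]_n) :=
  v != 0 /\ forall i, exists A : 'M[F]_n, v *m map_mx iota A = z i *: v.

(** Adjoining one number [z] at a time amounts to a tensor product: if [v] serves
the other numbers and [w] is an eigenvector for [z] of the companion matrix,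
the products of an entry of [w] by an entry of [v] serve them all. *)
Lemma joint_eigenvector_exists (N : nat) (z : 'I_N -> C) :
  (forall i, exists2 p : {poly F}, p \is monic & root (map_poly iota p) (z i)) ->
  exists n (v : 'rV[C]_n), joint_eigenvector z v.
Proof.
elim: N z => [|N IHN] z z_int.
  by exists 1, 1%:M; split; [exact: oner_neq0 | case].
have [//|n [v [v0 vA]]] := IHN (fun i => z (lift ord0 i)).
have [p p_mon pz] := z_int ord0.
pose B := companionmx p.
have /eigenvalueP[w wB w0] : eigenvalue (map_mx iota B) (z ord0).
  by rewrite eigenvalue_root_char -map_char_poly companionmxK.
exists ((size p).-1 * n)%N, (mxvec (w^T *m v)); split.
  rewrite mxvec_eq0; apply: contra_neq v0 => wv0.
  have [i wi] : exists i, w 0 i != 0.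
    by apply/existsP; apply: contra_neqT w0; rewrite negb_exists => /forallP w0;
      apply/rowP => i; rewrite mxE; apply/eqP; rewrite -[_ == _]negbK w0.
  apply/rowP => j; have /matrixP/(_ i j) := wv0.
  rewrite !mxE big_ord1 !mxE => /eqP; rewrite mulf_eq0 (negPf wi) /=.
  by move/eqP.
move=> i; case: (unliftP ord0 i) => [j|] ->.
  have [A vAj] := vA j; exists (lin_mulmxr A).
  rewrite /lin_mulmxr (map_lin_mx (gf := mulmxr (map_mx iota A))).
    by rewrite mul_vec_lin /= -mulmxA vAj -scalemxAr linearZ.
  by move=> X /=; rewrite map_mxM.
exists (lin_mulmx B^T).
rewrite /lin_mulmx (map_lin_mx (gf := mulmx (map_mx iota B^T))).
  rewrite mul_vec_lin /= mulmxA -map_trmx -trmx_mul wB linearZ /=.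
  by rewrite -scalemxAl linearZ.
by move=> X /=; rewrite map_mxM.
Qed.

(** In the smallest possible dimension the entries of [v] form a basis: a linear
relation [u] between them writes [v] as [w B] with fewer entries in [w], and
[w] is again a joint eigenvector. *)
Lemma joint_eigenvector_minimal (N : nat) (z : 'I_N -> C) :
  (forall i, exists2 p : {poly F}, p \is monic & root (map_poly iota p) (z i)) ->
  exists n (v : 'rV[C]_n), joint_eigenvector z v /\
    forall u : 'cV[F]_n, v *m map_mx iota u = 0 -> u = 0.
Proof.
move=> z_int.
pose P n := `[< exists v : 'rV[C]_n, joint_eigenvector z v >].
have exP : exists n, P n.
  by have [n ?] := joint_eigenvector_exists z_int; exists n; apply/asboolP.
have [n /asboolP[v [v0 vA]] n_min] := ex_minnP exP.
exists n, v; split => // u vu; apply/eqP; apply: contraT => u0.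
set B := row_base (kermx u).
have eqB : (map_mx iota B :=: map_mx iota (kermx u))%MS.
  by apply/map_eqmx; exact: eq_row_base.
have sub_v : (v <= map_mx iota B)%MS.
  by rewrite eqB map_kermx; apply/sub_kermxP.
have B_free : row_free B by exact: row_base_free.
have [w Ev] := submxP sub_v.
have rank_u : (0 < \rank u)%N by rewrite lt0n mxrank_eq0.
have rank_lt : (\rank (kermx u) < n)%N.
  rewrite mxrank_ker -subn_gt0 subKn ?rank_leq_row //.
suff /n_min : P (\rank (kermx u)) by rewrite leqNgt rank_lt.
apply/asboolP; exists w; split.
  by apply: contra_neq v0 => w0; rewrite Ev w0 mul0mx.
move=> i; have [A vAi] := vA i; exists (B *m A *m pinvmx B).
rewrite (map_mxM iota (B *m A)) (map_mxM iota B) !mulmxA -Ev vAi Ev.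
by rewrite -scalemxAl -mulmxA -map_mxM mulmxVp // map_mx1 mulmx1.
Qed.
End JointEigenvectors.

(** The normalized trace of a field extension is [F]-linear, and its value at an
element depends only on the minimal polynomial of this element.  Here the trace
is that of the multiplication matrices in a basis of the extension. *)
Lemma trace_form_relation (F : fieldType) (C : closedFieldType)
    (iota : {rmorphism F -> C}) (N d : nat) (z : 'I_N -> C)
    (p : 'I_N -> {poly F}) (m : 'I_N -> F) :
  [pchar F] =i pred0 ->
  (forall i, irreducible_poly (p i)) -> (forall i, p i \is monic) ->
  (forall i, size (p i) = d.+2) -> (forall i, root (map_poly iota (p i)) (z i)) ->
  \sum_i iota (m i) * z i = 0 -> \sum_i m i * (p i)`_d = 0.
Proof.
move=> F0 p_irr p_mon sp pz rel.
(* A zero-dimensional eigenvector is zero; otherwise the [A i] are the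
   multiplications by the [z i] in a basis. *)
have [|[|n] [v [[v0 /choice[A vA]] v_ind]]] := @joint_eigenvector_minimal _ _ iota N z.
- by move=> i; exists (p i).
- by move: v0; rewrite [v]thinmx0 eqxx.
have v_indM (B : 'M[F]_n.+1) : v *m map_mx iota B = 0 -> B = 0.
  move=> vB; apply/matrixP => i j.
  have /v_ind/matrixP/(_ i ord0) : v *m map_mx iota (col j B) = 0.
    by rewrite map_col !colE mulmxA vB mul0mx.
  by rewrite !mxE.
have sumA : \sum_i m i *: A i = 0.
  apply: v_indM; rewrite map_mx_sum mulmx_sumr.
  transitivity ((\sum_i iota (m i) * z i) *: v); last by rewrite rel scale0r.
  rewrite scaler_suml; by apply: eq_bigr => i _; rewrite map_mxZ -scalemxAr vA scalerA.
have pA i : horner_mx (A i) (p i) = 0.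
  apply: v_indM; rewrite map_horner_mx.
  have vq q : v *m horner_mx (map_mx iota (A i)) q = q.[z i] *: v.
    elim/poly_ind: q => [|q c IHq]; first by rewrite rmorph0 mulmx0 horner0 scale0r.
    rewrite rmorphD rmorphM /= horner_mx_X horner_mx_C mulmxDr mulmxA IHq.
    by rewrite -scalemxAl vA scalerA mul_mx_scalar hornerMXaddC scalerDl.
  by rewrite vq (rootP (pz i)) scale0r.
have trA i : d.+1%:R * \tr (A i) = - (n.+1%:R * (p i)`_d).
  exact: (trace_root_irreducible iota).
have n0 : n.+1%:R != 0 :> F by have /pcharf0P -> := F0.
apply: (mulfI n0); rewrite mulr0 mulr_sumr; apply/eqP; rewrite -oppr_eq0.
rewrite -sumrN; apply/eqP.
under eq_bigr do rewrite mulrCA -mulrN -trA mulrCA.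
rewrite -mulr_sumr; under eq_bigr do rewrite -mxtraceZ.
by rewrite -(raddf_sum (@mxtrace F n.+1)) sumA raddf0 mulr0.
Qed.

(** * Rational expressions in a transcendental number *)

Section AlgebraicNumbers.
Variable R : numFieldType.

Definition algebraic_pred : {pred R} :=
  fun x => `[< algebraicOver (ratr : rat -> R) x >].

Lemma algebraic_divring_closed : divring_closed algebraic_pred.
Proof.
split=> [|x y /asboolP ax /asboolP ay|x y /asboolP ax /asboolP ay]; apply/asboolP.
- exact: algebraic1.
- exact: algebraic_sub.
- exact: algebraic_div.
Qed.

HB.instance Definition _ :=
  GRing.isDivringClosed.Build R algebraic_pred algebraic_divring_closed.

Definition algebraic_number : Type := {x : R | x \in algebraic_pred}.
HB.instance Definition _ := SubType.on algebraic_number.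
HB.instance Definition _ := [Choice of algebraic_number by <:].
HB.instance Definition _ := [SubChoice_isSubIntegralDomain of algebraic_number by <:].
HB.instance Definition _ := [SubIntegralDomain_isSubField of algebraic_number by <:].

End AlgebraicNumbers.

Lemma algebraic_transcendental_root (R : numFieldType) (Q : R)
    (f : {poly algebraic_number R}) :
  ~ algebraicOver (ratr : rat -> R) Q -> (map_poly val f).[Q] = 0 -> f = 0.
Proof.
move=> Q_tr fQ; apply/eqP; apply: contra_notT Q_tr => f0.
apply/integral_algebraic.
apply: (@integral_root _ _ (@ratr R) (map_poly val f)).
- by rewrite map_poly_eq0.
- exact/rootP.
move=> _ /(nthP 0)[i _ <-]; rewrite coef_map /=.
by apply/integral_algebraic/asboolP; exact: (valP f`_i).
Qed.

Section RationalExpressions.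
Variables (k R : fieldType) (iota : {rmorphism k -> R}) (Q : R).

Local Notation ev f := (map_poly iota f).[Q].

Definition ratexpr_pred : {pred R} :=
  fun y => `[< exists f g : {poly k}, ev g != 0 /\ y = ev f / ev g >].

Lemma ratexpr_divring_closed : divring_closed ratexpr_pred.
Proof.
split=> [|_ _ /asboolP[f [g [g0 ->]]] /asboolP[f' [g' [g'0 ->]]]
         |_ _ /asboolP[f [g [g0 ->]]] /asboolP[f' [g' [g'0 ->]]]]; apply/asboolP.
- by exists 1, 1; rewrite rmorph1 hornerC oner_neq0 divr1.
- exists (f * g' - f' * g), (g * g'); rewrite rmorphB !rmorphM /=.
  rewrite !hornerE mulf_neq0 //; split => //.
  by rewrite mulrBl !invfM mulrACA mulfV // mulr1 [_^-1 * _^-1]mulrC mulrACA mulfV // mulr1.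
have [f'0|f'0] := eqVneq (ev f') 0.
  by exists 0, 1; rewrite rmorph1 rmorph0 hornerC oner_neq0 f'0 horner0 !mul0r invr0 mulr0.
exists (f * g'), (g * f'); rewrite !rmorphM /= !hornerM mulf_neq0 //; split => //.
by rewrite invf_div mulf_div.
Qed.

HB.instance Definition _ :=
  GRing.isDivringClosed.Build R ratexpr_pred ratexpr_divring_closed.

(** The field generated by [Q] over the image of [k], as a subtype of [R]. *)
Definition ratexpr : Type := {x : R | x \in ratexpr_pred}.
HB.instance Definition _ := SubType.on ratexpr.
HB.instance Definition _ := [Choice of ratexpr by <:].
HB.instance Definition _ := [SubChoice_isSubIntegralDomain of ratexpr by <:].
HB.instance Definition _ := [SubIntegralDomain_isSubField of ratexpr by <:].

Lemma ratexpr_const a : iota a \in ratexpr_pred.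
Proof.
by apply/asboolP; exists a%:P, 1; rewrite rmorph1 map_polyC !hornerC divr1 oner_neq0.
Qed.

Lemma ratexpr_var : Q \in ratexpr_pred.
Proof.
apply/asboolP; exists 'X, 1.
by rewrite rmorph1 map_polyX hornerX hornerC divr1 oner_neq0.
Qed.

Lemma ratexpr_poly (h : {poly R}) :
  (forall i, h`_i \in ratexpr_pred) -> exists p : {poly ratexpr}, map_poly val p = h.
Proof.
move=> hP; exists (map_poly (insubd (0 : ratexpr)) h).
apply/polyP => i; rewrite coef_map /= coef_map_id0; last first.
  by apply: val_inj; rewrite insubdK // rpred0.
by rewrite insubdK.
Qed.

Lemma ratexpr_pencil (p q : {poly k}) : exists P : {poly ratexpr},
  map_poly val P = map_poly iota p - Q *: map_poly iota q.
Proof.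
apply: ratexpr_poly => j; rewrite coefB coefZ !coef_map.
by rewrite rpredB ?rpredM ?ratexpr_const ?ratexpr_var.
Qed.

Hypothesis Q_tr : forall f : {poly k}, ev f = 0 -> f = 0.

Let homogenize (D : nat) (f g p : {poly k}) : {poly k} :=
  \sum_(i < D.+1) p`_i *: (f ^+ i * g ^+ (D - i)).

Let horner_homogenize D (f g p : {poly k}) : (size p <= D.+1)%N -> ev g != 0 ->
  ev (homogenize D f g p) = ev g ^+ D * (map_poly iota p).[ev f / ev g].
Proof.
move=> sp g0; rewrite (@horner_coef_wide _ D.+1 (map_poly iota p)) ?size_map_poly //.
rewrite /homogenize raddf_sum.
rewrite horner_sum mulr_sumr; apply: eq_bigr => i _.
rewrite /= map_polyZ hornerZ rmorphM !rmorphXn /= hornerM !horner_exp coef_map.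
rewrite [RHS]mulrCA; congr (_ * _); rewrite expr_div_n [RHS]mulrCA; congr (_ * _).
by rewrite expfB_cond // (negPf g0) add0n -ltnS.
Qed.

(** The argument of Gauss.  If [y = f / g] in lowest terms, clearing denominators
in [p(y) = Q q(y)] gives an identity between polynomials in the transcendental
[Q]; it shows that [g] divides a power of [f], so that [y] is a polynomial [h]
in [Q] with [p(h) = X q(h)].  By Bezout [q(h)] then divides [1], so [h] is
constant, and so is [p(h)]: this contradicts the factor [X]. *)
Lemma pencil_no_root (p q : {poly k}) (y : R) :
  coprimep p q -> (1 < size q < size p)%N -> y \in ratexpr_pred ->
  (map_poly iota p).[y] != Q * (map_poly iota q).[y].
Proof.
move=> cop /andP[sq spq] /asboolP[f1 [g1 [g10 Ey]]]; apply/eqP => py.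
pose d := gcdp f1 g1.
have g1n0 : g1 != 0 by apply: contra_neq g10 => ->; rewrite rmorph0 horner0.
have d0 : d != 0 by rewrite gcdp_eq0 negb_and g1n0 orbT.
pose f : {poly k} := f1 %/ d; pose g : {poly k} := g1 %/ d.
have Ef : f1 = f * d by rewrite divpK // dvdp_gcdl.
have Eg : g1 = g * d by rewrite divpK // dvdp_gcdr.
have /andP[g0 evd] : (ev g != 0) && (ev d != 0).
  by rewrite -negb_or -mulf_eq0 -hornerM -rmorphM -Eg.
have {}Ey : y = ev f / ev g.
  by rewrite Ey Ef Eg !rmorphM !hornerM -mulf_div divff // mulr1.
have cop_fg : coprimep f g by apply: coprimep_div_gcd; rewrite g1n0 orbT.
have [D sp] : exists D, size p = D.+2.
  by case: (size p) sq spq => [|[|D]] // sq; [case: (size q) sq => [|[]] | exists D].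
have Hpq : homogenize D.+1 f g p = 'X * homogenize D.+1 f g q.
  apply/eqP; rewrite -subr_eq0; apply/eqP/Q_tr; rewrite rmorphB rmorphM /=.
  rewrite map_polyX hornerD hornerN hornerM hornerX !horner_homogenize ?sp //; last first.
    by rewrite -sp ltnW.
  by rewrite -Ey py mulrCA subrr.
have g_dvd (h : {poly k}) : (size h <= D.+1)%N -> g %| homogenize D.+1 f g h.
  move=> sh; rewrite /homogenize big_ord_recr /= [h`_D.+1]nth_default // scale0r addr0.
  apply: (big_ind (fun x => g %| x)) => [||i _]; [exact: dvdp0|exact: dvdp_add|].
  by rewrite -mul_polyC; do 2!apply: dvdp_mull; rewrite subSn ?exprS ?dvdp_mulr // -ltnS.
have g_const : size g = 1%N.
  have : g %| p`_D.+1 *: f ^+ D.+1.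
    have -> : p`_D.+1 *: f ^+ D.+1 =
        'X * homogenize D.+1 f g q - homogenize D.+1 f g (p - p`_D.+1 *: 'X^(D.+1)).
      rewrite -Hpq /homogenize -sumrB big_ord_recr /= subnn mulr1.
      rewrite coefB coefZ coefXn eqxx mulr1 subrr scale0r subr0.
      rewrite big1 ?add0r // => i _.
      by rewrite coefB coefZ coefXn ltn_eqF // mulr0 subr0 subrr.
    apply: dvdp_sub; first by apply: dvdp_mull; rewrite g_dvd // -ltnS -sp.
    apply: g_dvd; apply/leq_sizeP => j; rewrite leq_eqVlt coefB coefZ coefXn.
    move=> /predU1P[<-|lt]; first by rewrite eqxx mulr1 subrr.
    by rewrite gtn_eqF // mulr0 subr0 nth_default // sp.
  rewrite dvdpZr; last first.
    by rewrite -[D.+1]/(D.+2.-1) -sp -lead_coefE lead_coef_eq0 -size_poly_gt0 sp.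
  rewrite -(mulr1 (f ^+ _)) Gauss_dvdpr ?coprimep_expr 1?coprimep_sym //.
  by rewrite dvdp1 => /eqP.
have [c c0 Eg1] : exists2 c, c != 0 & g = c%:P by apply/size_poly1P/eqP.
pose h := c^-1 *: f.
have {}Ey : y = ev h.
  by rewrite Ey Eg1 map_polyC hornerC map_polyZ hornerZ fmorphV mulrC.
have comp_h r : (map_poly iota r).[y] = ev (r \Po h).
  by rewrite map_comp_poly horner_comp Ey.
have {}py : p \Po h = 'X * (q \Po h).
  apply/eqP; rewrite -subr_eq0; apply/eqP/Q_tr; rewrite rmorphB rmorphM /=.
  by rewrite map_polyX hornerD hornerN hornerM hornerX -!comp_h py subrr.
have /Bezout_eq1_coprimepP[[u v] /= uv] := cop.
have qh1 : size (q \Po h) = 1%N.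
  have uvh : (u \Po h) * (p \Po h) + (v \Po h) * (q \Po h) = 1.
    by rewrite -!comp_polyM -comp_polyD uv -[1]/(1%:P) comp_polyC.
  apply/eqP; rewrite -dvdp1 -uvh.
  by rewrite py mulrA -mulrDl dvdp_mull.
have := size_comp_poly p h; rewrite py mulrC size_mulX -?size_poly_gt0 ?qh1 //.
have := size_comp_poly q h; rewrite qh1 /=.
case: (size q) sq => [|[|a]] // _; rewrite mulSn => /esym/eqP.
by rewrite addn_eq0 => /andP[/eqP -> _]; rewrite muln0.
Qed.

Lemma pencil_irreducible (p q : {poly k}) (P : {poly ratexpr}) :
  coprimep p q -> (1 < size q < size p)%N -> (size p <= 4)%N ->
  map_poly val P = map_poly iota p - Q *: map_poly iota q ->
  irreducible_poly P.
Proof.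
move=> cop sz sp EP.
have sP : size P = size p.
  rewrite -(size_map_poly (val : {rmorphism ratexpr -> R})) EP size_polyDl ?size_map_poly //.
  rewrite size_polyN; apply: leq_ltn_trans (size_scale_leq _ _) _.
  by rewrite size_map_poly; case/andP: sz.
apply: cubic_irreducible; first by rewrite sP sp andbT; case/andP: sz => [/ltn_trans]; apply.
move=> y; apply/negP => /rootP Py.
have := pencil_no_root cop sz (valP y); rewrite -subr_eq0 => /eqP[].
rewrite -hornerZ -hornerN -hornerD -EP.
by rewrite horner_map Py rmorph0.
Qed.

End RationalExpressions.

(** * The cubics of the joint spectrum and their integer relations *)

(** On the joint eigenspace with [x = w + 1 / w], the characteristic polynomial of
the adjacency matrix is [pencil_cubic x].  The weight [Q] subtracts from it [Q]
times the minor of the two other orbits, which is [pencil_quadratic u v] for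
[(u, v)] equal to [(0, 1)], [(x, 1)] or [(x, 2 + x)], according to the orbit. *)
Definition pencil_cubic (k : comNzRingType) (x : k) : {poly k} :=
  'X^3 - x%:P * 'X^2 - (4 + x)%:P * 'X - 2%:P.

Definition pencil_quadratic (k : comNzRingType) (u v : k) : {poly k} :=
  'X^2 - u%:P * 'X - v%:P.

(** The remainder of [pencil_cubic x] by [pencil_quadratic u v] is [-(s X + t)], and
this is [s ^ 2] times the value of the quadratic at [- t / s]. *)
Definition pencil_resultant (k : comNzRingType) (x u v : k) : k :=
  let s := 4 + x - v - u * (u - x) in let t := 2 - v * (u - x) in
  t ^+ 2 + u * s * t - v * s ^+ 2.

Section PencilPolys.
Variables (k : fieldType) (x u v : k).

Lemma size_pencil_cubic : size (pencil_cubic x) = 4.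
Proof.
rewrite /pencil_cubic -!addrA size_polyDl ?size_polyXn // !addrA.
rewrite -!opprD size_polyN.
apply: (leq_ltn_trans (size_polyD _ _)); rewrite gtn_max size_polyC.
rewrite [X in _ && X](leq_ltn_trans (leq_b1 _)) // andbT.
apply: (leq_ltn_trans (size_polyD _ _)); rewrite gtn_max !mul_polyC.
rewrite !(leq_ltn_trans (size_scale_leq _ _)) ?size_polyX ?size_polyXn //.
Qed.

Lemma size_pencil_quadratic : size (pencil_quadratic u v) = 3.
Proof.
rewrite /pencil_quadratic -!addrA size_polyDl ?size_polyXn // -!opprD size_polyN.
apply: (leq_ltn_trans (size_polyD _ _)); rewrite gtn_max size_polyC mul_polyC.
by rewrite !(leq_ltn_trans (size_scale_leq _ _)) ?size_polyX // (leq_ltn_trans (leq_b1 _)).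
Qed.

(** A Bezout relation whose right-hand side is the resultant; its coefficients come
from two steps of the Euclidean algorithm. *)
Lemma pencil_coprime :
  pencil_resultant x u v != 0 -> coprimep (pencil_cubic x) (pencil_quadratic u v).
Proof.
move=> c0; apply/Bezout_coprimepP.
pose s := 4 + x - v - u * (u - x); pose t := 2 - v * (u - x).
pose a : {poly k} := s%:P * 'X - (u * s + t)%:P.
exists (a, (s ^+ 2)%:P - a * ('X - (x - u)%:P)) => /=.
rewrite (_ : _ + _ = (pencil_resultant x u v)%:P) ?polyC_eqp1 //.
rewrite /a /pencil_cubic /pencil_quadratic /pencil_resultant /s /t.
ring.
Qed.
End PencilPolys.

Lemma rmorph_pencil_resultant (k R : comNzRingType) (iota : {rmorphism k -> R}) (x u v : k) :
  pencil_resultant (iota x) (iota u) (iota v) = iota (pencil_resultant x u v).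
Proof. rewrite /pencil_resultant; ring. Qed.

Lemma map_pencil (k R : fieldType) (iota : {rmorphism k -> R}) (x u v : k) :
  map_poly iota (pencil_cubic x) = pencil_cubic (iota x) /\
  map_poly iota (pencil_quadratic u v) = pencil_quadratic (iota u) (iota v).
Proof.
have Xn n : map_poly iota 'X^n = 'X^n by rewrite rmorphXn /= map_polyX.
have CM c p : map_poly iota (c%:P * p) = (iota c)%:P * map_poly iota p.
  by rewrite rmorphM /= map_polyC.
rewrite /pencil_cubic /pencil_quadratic !rmorphB /= !CM !Xn !map_polyX !map_polyC.
by rewrite rmorphD /= !rmorph_nat.
Qed.

(** The three resultants are [-(5 + 2 x)], [x ^ 2 - 5] and [-4]. *)
Lemma pencil_resultant_neq0 (R : realFieldType) (x : R) : -2 <= x <= 2 ->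
  [/\ pencil_resultant x 0 1 != 0, pencil_resultant x x 1 != 0 &
      pencil_resultant x x (2 + x) != 0].
Proof.
by move=> hx; rewrite /pencil_resultant; split; apply/eqP => res; nra.
Qed.

(** The minimal polynomial of [l i] over the field of rational expressions in [Q] is
[p - Q q], a cubic in which the opposite of the coefficient of degree 2 is
[x i + Q]. *)
Lemma pencil_trace_relation (k : fieldType) (R : realType)
    (iota : {rmorphism k -> R}) (Q : R) (N : nat)
    (l x u v : 'I_N -> R) (m : 'I_N -> int) :
  (forall f : {poly k}, (map_poly iota f).[Q] = 0 -> f = 0) ->
  (forall i, exists y, iota y = x i) -> (forall i, exists y, iota y = u i) ->
  (forall i, exists y, iota y = v i) ->
  (forall i, pencil_resultant (x i) (u i) (v i) != 0) ->
  (forall i, (pencil_cubic (x i)).[l i] = Q * (pencil_quadratic (u i) (v i)).[l i]) ->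
  \sum_i (m i)%:~R * l i = 0 ->
  \sum_i (m i)%:~R * x i + Q * \sum_i (m i)%:~R = 0.
Proof.
move=> Q_tr /choice[x' Ex] /choice[u' Eu] /choice[v' Ev] res0 root_l rel.
have mapE i : map_poly iota (pencil_cubic (x' i)) = pencil_cubic (x i) /\
    map_poly iota (pencil_quadratic (u' i) (v' i)) = pencil_quadratic (u i) (v i).
  by rewrite -Ex -Eu -Ev; exact: map_pencil.
pose F := ratexpr iota Q.
pose inR : {rmorphism F -> R} := val.
pose kap : {rmorphism F -> complexC R} := real_complex R \o inR.
have /choice[P EP] i : exists P : {poly F}, map_poly inR P =
    pencil_cubic (x i) - Q *: pencil_quadratic (u i) (v i).
  by have [<- <-] := mapE i; exact: ratexpr_pencil.
have irrP i : irreducible_poly (P i).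
  apply: (@pencil_irreducible _ _ _ _ Q_tr (pencil_cubic (x' i))
            (pencil_quadratic (u' i) (v' i))).
  - apply: pencil_coprime; have := res0 i; rewrite -Ex -Eu -Ev.
    by rewrite rmorph_pencil_resultant fmorph_eq0.
  - by rewrite size_pencil_cubic size_pencil_quadratic.
  - by rewrite size_pencil_cubic.
  - by have [-> ->] := mapE i; exact: EP.
have cP i j : inR (P i)`_j = (pencil_cubic (x i))`_j - Q * (pencil_quadratic (u i) (v i))`_j.
  by rewrite -(coef_map inR) EP coefB coefZ.
have sP i : size (P i) = 4.
  rewrite -(size_map_poly inR) EP.
  rewrite size_polyDl ?size_pencil_cubic // size_polyN.
  by rewrite (leq_ltn_trans (size_scale_leq _ _)) // size_pencil_quadratic.
have monP i : P i \is monic.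
  apply/monicP; apply: (fmorph_inj inR); rewrite lead_coefE sP cP rmorph1.
  rewrite /pencil_cubic /pencil_quadratic !coefB !coefCM !coefXn !coefX !coefC /=.
  by rewrite !mulr0 !subr0 mulr0 subr0.
have rootP_l i : root (map_poly kap (P i)) (l i)%:C%C.
  rewrite /kap map_poly_comp fmorph_root; apply/rootP; rewrite EP.
  by rewrite hornerD hornerN hornerZ root_l subrr.
have char0 : [pchar F] =i pred0.
  by apply/pcharf0P => n; rewrite -(fmorph_eq0 inR) rmorph_nat pnatr_eq0.
have := @trace_form_relation F (complexC R) kap N 2 (fun i => (l i)%:C%C) P
   (fun i => (m i)%:~R) char0 irrP monP sP rootP_l.
have -> : \sum_i kap (m i)%:~R * (l i)%:C%C = 0.
  rewrite -[RHS](rmorph0 (real_complex R)) -rel rmorph_sum; apply: eq_bigr => i _.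
  by rewrite rmorph_int rmorphM /= rmorph_int.
move=> /(_ erefl)/(congr1 inR).
rewrite rmorph_sum rmorph0 => trace_rel.
rewrite mulr_sumr -big_split -[RHS]oppr0 -[X in _ = - X]trace_rel -sumrN.
apply: eq_bigr => i _.
rewrite rmorphM rmorph_int cP /pencil_cubic /pencil_quadratic.
rewrite !coefB !coefCM !coefXn !coefX !coefC /=.
ring.
Qed.

Lemma pencil_eigenvalue_relation (R : realType) (Q : R) (N : nat)
    (l x u v : 'I_N -> R) (m : 'I_N -> int) :
  ~ algebraicOver (ratr : rat -> R) Q ->
  (forall i, [/\ x i \in @algebraic_pred R, u i \in @algebraic_pred R
      & v i \in @algebraic_pred R]) ->
  (forall i, pencil_resultant (x i) (u i) (v i) != 0) ->
  (forall i, (pencil_cubic (x i)).[l i] = Q * (pencil_quadratic (u i) (v i)).[l i]) ->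
  \sum_i (m i)%:~R * l i = 0 -> \sum_i (m i)%:~R * x i = 0.
Proof.
move=> Q_tr alg res0 root_l rel.
pose K := algebraic_number R.
pose iota : {rmorphism K -> R} := val.
have Q_ev (f : {poly K}) : (map_poly iota f).[Q] = 0 -> f = 0.
  exact: algebraic_transcendental_root.
have lift (y : R) : y \in @algebraic_pred R -> exists y', iota y' = y.
  by move=> h; exists (Sub y h); exact: SubK.
have trace_rel : \sum_i (m i)%:~R * x i + Q * \sum_i (m i)%:~R = 0.
  apply: (pencil_trace_relation Q_ev _ _ _ res0 root_l rel) => i;
    by apply: lift; case: (alg i).
have [S0|S0] := eqVneq (\sum_i (m i)%:~R : R) 0.
  by move: trace_rel; rewrite S0 mulr0 addr0.
move/eqP: trace_rel; rewrite addrC addr_eq0 => /eqP QE; case: Q_tr.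
suff : Q \in @algebraic_pred R by move=> /asboolP.
rewrite -[Q](mulfK S0) QE rpred_div ?rpredN ?rpred_sum // => i _.
  by case: (alg i) => h _ _; rewrite rpredM ?rpred_int.
by rewrite rpred_int.
Qed.

(** * Kronecker approximation for positive times *)

Section Cis.
Variable R : realType.
Definition cis (a : R) : complexC R := (cos a +i* sin a)%C.

Lemma cisD a b : cis (a + b) = cis a * cis b.
Proof.
rewrite /cis cosD sinD; apply/eqP.
by rewrite eq_complex /= [sin a * _ + _]addrC !eqxx.
Qed.

Lemma cis0 : cis 0 = 1.
Proof. by rewrite /cis cos0 sin0. Qed.

Lemma cisMn a n : cis (a *+ n) = cis a ^+ n.
Proof. by elim: n => [|n IHn]; rewrite ?cis0 // mulrS cisD IHn exprS. Qed.

Lemma cis_sum (I : Type) (r : seq I) (P : pred I) (f : I -> R) :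
  cis (\sum_(i <- r | P i) f i) = \prod_(i <- r | P i) cis (f i).
Proof. exact: (big_morph cis cisD cis0). Qed.

Lemma normc_cis a : `|cis a| = 1.
Proof. by rewrite normc_def /= cos2Dsin2 sqrtr1. Qed.

(** This factorization turns a power of [2 + 2 cos a] into a binomial expansion. *)
Lemma sqr_cisD1 a : (1 + cis a) ^+ 2 * cis (- a) = (2 + 2 * cos a)%:C%C.
Proof.
have -> : (1 + cis a) ^+ 2 = 1 + 2 * cis a + cis a * cis a by ring.
rewrite !mulrDl mul1r -mulrA -mulrA -cisD subrr cis0 !mulr1.
apply/eqP; rewrite eq_complex /= cosN sinN; apply/andP; split; apply/eqP; simpc; ring.
Qed.

(** The Bohr kernel of Kronecker's theorem is a sum of cosines with nonnegative
coefficients. *)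
Lemma cos_product_expansion (n p : nat) (a : 'I_n -> R) :
  \prod_i (2 + 2 * cos (a i)) ^+ p =
  \sum_(f : {ffun 'I_n -> 'I_p.*2.+1})
     (\prod_i 'C(p.*2, f i)%:R) * cos (\sum_i (a i *+ f i - a i *+ p)).
Proof.
have factor x : ((2 + 2 * cos x) ^+ p)%:C%C =
    \sum_(k < p.*2.+1) 'C(p.*2, k)%:R * cis (x *+ k - x *+ p).
  rewrite rmorphXn /= -sqr_cisD1 exprMn -exprM mul2n -cisMn exprDn mulr_suml.
  apply: eq_bigr => k _; rewrite expr1n mul1r -mulNrn cisD [cis (x *+ k)]cisMn.
  by rewrite -mulr_natl mulrA.
transitivity (complex.Re ((\prod_i (2 + 2 * cos (a i)) ^+ p)%:C%C : complexC R)) => //.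
rewrite rmorph_prod /=; under eq_bigr do rewrite factor.
rewrite bigA_distr_bigA /=.
have -> : \sum_(f : {ffun 'I_n -> 'I_p.*2.+1}) \prod_i
    ('C(p.*2, f i)%:R * cis (a i *+ f i - a i *+ p)) =
    \sum_(f : {ffun 'I_n -> 'I_p.*2.+1})
      (\prod_i 'C(p.*2, f i)%:R)%:C%C * cis (\sum_i (a i *+ f i - a i *+ p)).
  apply: eq_bigr => f _; rewrite big_split /= cis_sum rmorph_prod /=.
  by congr (_ * _); apply: eq_bigr => i _; rewrite rmorph_nat.
rewrite (big_morph (@complex.Re R) (id1 := 0) (op1 := +%R)) //; last by case=> ? ? [].
by apply: eq_bigr => f _; rewrite /= mul0r subr0.
Qed.

Lemma sum_cos_bound (x y : R) (J : nat) : sin (x / 2) != 0 ->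
  `|\sum_(j < J) cos (x *+ j - y)| <= `|sin (x / 2)|^-1.
Proof.
move=> sx; have tele : (\sum_(j < J) cos (x *+ j - y)) * (2 * sin (x / 2)) =
    sin (x *+ J - x / 2 - y) - sin (- (x / 2) - y).
  elim: J => [|J IHJ]; first by rewrite big_ord0 mul0r mulr0n sub0r subrr.
  rewrite big_ord_recr mulrDl IHJ /= addrAC; congr (_ - _).
  have -> : x *+ J - x / 2 - y = (x *+ J - y) - x / 2 by ring.
  have -> : x *+ J.+1 - x / 2 - y = (x *+ J - y) + x / 2 by rewrite mulrS; field.
  by move: (x *+ J - y) => A; rewrite sinB sinD; ring.
have s0 : 0 < `|2 * sin (x / 2)| by rewrite normr_gt0 mulf_neq0.
rewrite -(ler_pM2r s0) -normrM tele normrM mulrCA mulVf ?normr_eq0 // mulr1.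
rewrite (le_trans (ler_normB _ _)) // (le_trans (lerD (sin_max _) (sin_max _))) //.
by rewrite ger0_norm.
Qed.

(** Averages along the arithmetic progression of step [tau].  The terms of zero
frequency are constant and nonnegative, and the other ones have bounded sums,
so that the averages have a limit at least [c i0].  The phases of the
zero-frequency terms must vanish, otherwise these terms could cancel. *)
Lemma mean_value_bound (I : finType) (c nu phi : I -> R) (B : R) (i0 : I) :
  (forall i, 0 <= c i) -> (forall i, nu i = 0 -> phi i = 0) -> nu i0 = 0 ->
  (forall t, 0 <= t -> \sum_i c i * cos (t * nu i - phi i) <= B) -> c i0 <= B.
Proof.
move=> c0 phi0 nu0 bound; rewrite leNgt; apply/negP => Bc.
(* With this step [tau * nu i] stays in the interval from -1 to 1, so the angles
   [tau * nu i / 2] with nonzero frequency avoid the multiples of pi. *)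
pose tau : R := (1 + \sum_i `|nu i|)^-1.
have S0 : 0 < 1 + \sum_i `|nu i| by rewrite ltr_pwDl // sumr_ge0.
have tau0 : 0 < tau by rewrite invr_gt0.
have tau_sin i : nu i != 0 -> sin (tau * nu i / 2) != 0.
  move=> nui; have lt1 : `|tau * nu i| < 1.
    rewrite normrM gtr0_norm // mulrC ltr_pdivrMr // mul1r.
    by rewrite (bigD1 i) //= addrCA ltrDl ltr_pwDl // sumr_ge0.
  have h : 0 < `|tau * nu i / 2| < 2.
    by rewrite normr_gt0 !mulf_neq0 ?(gt_eqF tau0) //= normrM [`|2^-1|]ger0_norm //; lra.
  apply/eqP => s0; have := sin2_gt0 h; case: (ler0P (tau * nu i / 2)) => _.
    by rewrite sinN s0 oppr0 ltxx.
  by rewrite s0 ltxx.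
pose M := \sum_i c i * `|sin (tau * nu i / 2)|^-1.
have avg J : c i0 * J%:R - M <= J%:R * B.
  have -> : J%:R * B = \sum_(j < J) B by rewrite sumr_const card_ord mulr_natl.
  apply: (@le_trans _ _
    (\sum_(j < J) \sum_i c i * cos (tau * j%:R * nu i - phi i))); last first.
    by apply: ler_sum => j _; apply: bound; rewrite mulr_ge0 // ltW.
  rewrite exchange_big /= (bigD1 i0) //= /M (bigD1 i0) //=.
  rewrite opprD addrA lerD //.
    rewrite (eq_bigr (fun=> c i0)) => [|j _]; last first.
      by rewrite nu0 (phi0 _ nu0) mulr0 subr0 cos0 mulr1.
    by rewrite sumr_const card_ord mulr_natr gerBl mulr_ge0 // invr_ge0.
  rewrite -sumrN; apply: ler_sum => i _; rewrite -mulr_sumr -mulrN ler_wpM2l //.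
  have [nui|nui] := eqVneq (nu i) 0.
    apply: (@le_trans _ _ 0); first by rewrite oppr_le0 invr_ge0.
    by apply: sumr_ge0 => j _; rewrite nui (phi0 _ nui) mulr0 subr0 cos0.
  under eq_bigr do rewrite mulrAC mulr_natr.
  by have := sum_cos_bound (phi i) J (tau_sin _ nui); rewrite ler_norml => /andP[].
have [J] : exists J : nat, M / (c i0 - B) < J%:R.
  by exists (Num.truncn (M / (c i0 - B))).+1; exact: truncnS_gt.
rewrite ltr_pdivrMr ?subr_gt0 // => ltM; have := avg J; lra.
Qed.

End Cis.

(** Halving keeps the difference of the arguments below [2 pi]. *)
Lemma cis_half_inj (R : realType) (x y : R) : -2 <= x <= 2 -> -2 <= y <= 2 ->
  cis (x / 2) = cis (y / 2) -> x = y.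
Proof.
move=> hx hy [ec es]; pose z := (x - y) / 4.
have cz : cos (z *+ 2) = 1.
  have -> : z *+ 2 = x / 2 - y / 2 by rewrite /z mulr2n; field.
  by rewrite cosB ec es -!expr2 cos2Dsin2.
have sz : sin z = 0.
  apply/eqP; rewrite -sqrf_eq0 sin2cos2; apply/eqP.
  by move: cz; rewrite cos_mulr2n mulr2n; lra.
have [z0|z0|z0] := ltgtP z 0.
- have : 0 < sin (- z) by apply: sin2_gt0; move: z0; rewrite /z; lra.
  by rewrite sinN sz oppr0 ltxx.
- have : 0 < sin z by apply: sin2_gt0; move: z0; rewrite /z; lra.
  by rewrite sz ltxx.
by move: z0; rewrite /z; lra.
Qed.

Lemma central_bin_ge (p : nat) : (4 ^ p <= p.*2.+1 * 'C(p.*2, p))%N.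
Proof.
elim: p => // p IHp; rewrite doubleS.
have step : (p.+1 * 'C(p.*2.+2, p.+1) = 2 * (p.*2.+1 * 'C(p.*2, p)))%N.
  have e1 := mul_bin_diag p.*2.+2 p; have e2 := mul_bin_down p.*2.+1 p.
  move: e1 e2 => /=; rewrite !subSn -?addnn ?leq_addr // addnK; nia.
rewrite expnS -(leq_pmul2l (ltn0Sn p)) [leqRHS]mulnCA step; nia.
Qed.

Section Kronecker.
Variable R : realType.

(** With [p = m (n + 1)], the Bernoulli inequality bounds the inverse of [q ^ p]
below by a multiple of [m ^ (n + 1)], of larger order than [p ^ n]. *)
Lemma geometric_beats_polynomial (n : nat) (q : R) :
  q < 1 -> 0 <= q -> exists p : nat, (p.*2.+1)%:R ^+ n * q ^+ p < 1.
Proof.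
move=> q1; rewrite le_eqVlt => /predU1P[<-|q0].
  by exists 1%N; rewrite mulr0 ltr01.
pose h := q^-1 - 1.
have h0 : 0 < h by rewrite subr_gt0 invf_gt1.
pose c : R := (2 * n + 3)%:R ^+ n / h ^+ n.+1.
pose m := (Num.truncn c).+1.
have cm : c < m%:R by exact: truncnS_gt.
exists (m * n.+1)%N.
have bern : m%:R * h <= q^-1 ^+ m.
  rewrite -[q^-1](subrK 1) -/h addrC; elim: (m) => [|k IHk].
    by rewrite mul0r expr0.
  rewrite exprS; have : 1 <= (1 + h) ^+ k by rewrite exprn_ege1 // lerDl ltW.
  rewrite -natr1; nra.
rewrite -ltr_pdivlMr ?exprn_gt0 // div1r -exprVn exprM.
apply: (@lt_le_trans _ _ ((m%:R * h) ^+ n.+1)); last first.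
  by rewrite lerXn2r ?nnegrE // ?exprn_ge0 ?mulr_ge0 ?invr_ge0 // ltW.
apply: (@le_lt_trans _ _ ((m * (2 * n + 3))%:R ^+ n)).
  by rewrite lerXn2r ?nnegrE // ler_nat -addnn /m; nia.
rewrite natrM !exprMn [m%:R ^+ n.+1]exprS -mulrA [ltRHS]mulrCA.
rewrite ltr_pM2l ?exprn_gt0 // ?ltr0n //.
by rewrite -ltr_pdivrMr ?exprn_gt0.
Qed.

(** If at every [t >= 0] some cosine is at most [1 - eps], the kernel
[prod_i (2 + 2 cos (t l_i - th_i)) ^ p] is at most [4 ^ (n p) q ^ p] with
[q < 1].  By the hypothesis on integer relations its zero-frequency terms have
zero phase, so its mean is at least the central coefficient ['C(2 p, p) ^ n],
which is [4 ^ (n p)] up to a factor polynomial in [p]. *)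
Lemma kronecker (n : nat) (l th : 'I_n -> R) :
  (forall m : 'I_n -> int, \sum_i (m i)%:~R * l i = 0 ->
     \sum_i (m i)%:~R * th i = 0) ->
  forall eps, 0 < eps ->
  exists2 t, 0 <= t & forall i, 1 - eps < cos (t * l i - th i).
Proof.
move=> rel eps eps0; apply: contrapT => /forall2NP noT.
(* The minimum keeps [q] nonnegative when [eps] is large. *)
pose q : R := 1 - Num.min eps 1 / 2.
have [q0 q1 qe] : [/\ 0 <= q, q < 1 & 2 - eps <= 2 * q].
  by rewrite /q; case: (leP eps 1) => h; split; lra.
have [p] := geometric_beats_polynomial n q1 q0; apply/negP; rewrite -leNgt.
pose c (f : {ffun 'I_n -> 'I_p.*2.+1}) : R := \prod_i 'C(p.*2, f i)%:R.
pose m (f : {ffun 'I_n -> 'I_p.*2.+1}) i : int := (f i)%:Z - p%:Z.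
have p_lt : (p < p.*2.+1)%N by rewrite ltnS -addnn leq_addr.
pose f0 : {ffun 'I_n -> 'I_p.*2.+1} := [ffun=> Ordinal p_lt].
have : c f0 <= 4 ^+ (n * p) * q ^+ p.
  apply: (@mean_value_bound R _ c (fun f => \sum_i (m f i)%:~R * l i)
            (fun f => \sum_i (m f i)%:~R * th i)).
  - by move=> f; apply: prodr_ge0 => i _.
  - by move=> f; exact: rel.
  - by rewrite big1 // => i _; rewrite /m ffunE subrr mul0r.
  move=> t t0; have [i /negP]: exists i, ~ (1 - eps < cos (t * l i - th i)).
    apply/not_existsP => noi; case: (noT t) => [/(_ t0)//|h].
    by apply: h => i; apply: contrapT; exact: noi.
  rewrite -leNgt => cosi.
  have -> : \sum_f c f * cos (t * (\sum_i (m f i)%:~R * l i) - \sum_i (m f i)%:~R * th i)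
     = \prod_i (2 + 2 * cos (t * l i - th i)) ^+ p.
    rewrite cos_product_expansion; apply: eq_bigr => f _; congr (_ * cos _).
    rewrite mulr_sumr -sumrB; apply: eq_bigr => j _.
    have -> : (m f j)%:~R = (f j)%:R - p%:R :> R by rewrite /m intrB.
    set x := t * l j - th j; rewrite -(mulr_natr x (f j)) -(mulr_natr x p) /x; ring.
  rewrite prodrXl exprM -exprMn lerXn2r ?nnegrE //.
  - apply: prodr_ge0 => j _; have := cos_geN1 (t * l j - th j); lra.
  - by rewrite mulr_ge0 // exprn_ge0.
  rewrite (bigD1 i) //=.
  have -> : 4 ^+ n * q = (4 * q) * \prod_(j < n | j != i) 4.
    have n1 : n = n.-1.+1 by case: (n) i {cosi} => // -[].
    by rewrite prodr_const cardC1 card_ord {1}n1 exprS mulrAC.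
  apply: ler_pM => //.
  - by apply: prodr_ge0 => j _; have := cos_geN1 (t * l j - th j); lra.
  - lra.
  apply: ler_prod => j _; have := cos_geN1 (t * l j - th j).
  by have := cos_le1 (t * l j - th j); lra.
have -> : c f0 = 'C(p.*2, p)%:R ^+ n.
  by rewrite /c; under eq_bigr do rewrite ffunE; rewrite prodr_const card_ord.
move=> le_c; have P0 : 0 < 4 ^+ (n * p) :> R by rewrite exprn_gt0.
rewrite -(ler_pM2l P0) mulr1 mulrCA.
have : 4 ^+ (n * p) <= (p.*2.+1)%:R ^+ n * 'C(p.*2, p)%:R ^+ n :> R.
  rewrite mulnC exprM -exprMn lerXn2r ?nnegrE ?mulr_ge0 //.
  by rewrite -natrX -natrM ler_nat central_bin_ge.
by move=> /le_trans; apply; rewrite ler_wpM2l // exprn_ge0.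
Qed.

End Kronecker.

(** * Exponentials of diagonalizable matrices *)

Section MatrixExponential.
Local Open Scope classical_set_scope.

Lemma cvg_mx (T : ptopologicalType) (m n : nat) (f : nat -> 'M[T]_(m, n))
    (M : 'M[T]_(m, n)) :
  (forall i j, f k i j @[k --> \oo] --> M i j) -> f @ \oo --> M.
Proof.
move=> fM A [P MP PA]; apply: filterS (_ : \forall k \near \oo, forall i j, P i j (f k i j)).
  by move=> k Pk; exact: PA.
by apply: filter_forall => i; apply: filter_forall => j; exact: fM.
Qed.

Lemma expmx_conj_diag (C : numFieldType) (n : nat) (V : 'M[C]_n) (d e : 'rV[C]_n) :
  V \in unitmx ->
  (forall i, series (fun k => (k`!%:R)^-1 * d 0 i ^+ k) @ \oo --> e 0 i) ->
  expmx (invmx V *m diag_mx d *m V) = invmx V *m diag_mx e *m V.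
Proof.
move=> Vu de; apply: cvg_lim; first exact: norm_hausdorff.
have powE k : (invmx V *m diag_mx d *m V) ^+ k =
    invmx V *m diag_mx (\row_i d 0 i ^+ k) *m V.
  elim: k => [|k IHk].
    rewrite expr0 (_ : diag_mx _ = 1%:M) ?mulmx1 ?mulVmx //.
    by rewrite -diag_const_mx; congr diag_mx; apply/rowP => i; rewrite !mxE expr0.
  rewrite exprS IHk -mulmxE !mulmxA mulmxK // -[_ *m diag_mx _ *m diag_mx _]mulmxA.
  by rewrite mulmx_diag; congr (_ *m diag_mx _ *m _); apply/rowP => i; rewrite !mxE exprS.
pose s k : 'rV[C]_n := \row_i series (fun k => (k`!%:R)^-1 * d 0 i ^+ k) k.
have -> : series (fun k => (k`!%:R)^-1 *: (invmx V *m diag_mx d *m V) ^+ k) =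
    fun k => invmx V *m diag_mx (s k) *m V.
  apply/funext => k; rewrite /series /= /s; elim: k => [|k IHk].
    rewrite big_geq // (_ : diag_mx _ = 0) ?mulmx0 ?mul0mx //.
    by apply/matrixP => i j; rewrite !mxE /series /= big_geq // mul0rn.
  rewrite big_nat_recr //= IHk powE scalemxAl scalemxAr -mulmxDl -mulmxDr.
  congr (_ *m _ *m _); apply/matrixP => i j; rewrite !mxE /series /= big_nat_recr //=.
  by rewrite mulrnDl mulrnAr.
have entry (r : 'rV[C]_n) i j : (invmx V *m diag_mx r *m V) i j =
    \sum_k (invmx V i k * V k j) * r 0 k.
  rewrite mxE; apply: eq_bigr => k _; rewrite mul_mx_diag mxE.
  by rewrite mulrAC.
apply: cvg_mx => i j; rewrite entry; under eq_fun do rewrite entry.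
apply: cvg_big => [|k _]; first exact: add_continuous.
apply: cvgMl_tmp; under eq_fun do rewrite mxE.
exact: de.
Qed.

End MatrixExponential.

Section UnitaryEvolution.
Variable R : realType.
Local Open Scope classical_set_scope.

Lemma cvg_complex (u v : nat -> R) (a b : R) :
  u @ \oo --> a -> v @ \oo --> b ->
  ((u k +i* v k)%C : complexC R) @[k --> \oo] --> ((a +i* b)%C : complexC R).
Proof.
move=> ua vb; apply/cvgrPdist_lt => /= eps eps0.
have [e e0 ->] : exists2 e : R, 0 < e & eps = e%:C%C.
  exists (complex.Re eps); first by move: eps0; rewrite ltcE => /andP[].
  by rewrite RRe_real // gtr0_real.
have e2 : 0 < e / 2 by rewrite divr_gt0.
near=> k.
have uk : `|a - u k| < e / 2 by near: k; apply: (cvgrPdist_lt _ _).1.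
have vk : `|b - v k| < e / 2 by near: k; apply: (cvgrPdist_lt _ _).1.
have -> : (a +i* b)%C - (u k +i* v k)%C = (a - u k)%:C%C + 'i%C * (b - v k)%:C%C :> complexC R.
  by simpc.
apply: le_lt_trans (ler_normD _ _) _; rewrite normrM !normc_def /=.
rewrite expr0n /= add0r expr1n sqrtr1 mul1r !addr0 !sqrtr_sqr -rmorphD ltcR; lra.
Unshelve. all: by end_near. Qed.

Lemma imaginary_power (k : nat) :
  ('i%C : R[i]) ^+ k =
  ((~~ odd k)%:R * (-1) ^+ k./2 +i* ((odd k)%:R * (-1) ^+ k.-1./2))%C.
Proof.
rewrite -{1}(odd_double_half k) exprD -mul2n exprM sqr_i.
have -> : ((-1 : R[i]) ^+ k./2) = ((-1) ^+ k./2 : R)%:C%C by rewrite rmorphXn rmorphN1.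
have half : odd k -> k.-1./2 = k./2.
  by move=> k_odd; rewrite -{1}(odd_double_half k) k_odd /= doubleK.
case: (odd k) half => [->//|_] /=.
  by apply/eqP; rewrite expr1 eq_complex /=; apply/andP; split; apply/eqP; ring.
by apply/eqP; rewrite expr0 mul1r eq_complex /=; apply/andP; split; apply/eqP; ring.
Qed.

Lemma series_cis (x : R) :
  series (fun k => (k`!%:R)^-1 * ((0 +i* x)%C : complexC R) ^+ k) @ \oo --> cis x.
Proof.
have -> : series (fun k => (k`!%:R)^-1 * ((0 +i* x)%C : complexC R) ^+ k) =
    fun k => (series (cos_coeff x) k +i* series (sin_coeff x) k)%C.
  apply/funext => k; rewrite /series /=; elim: k => [|k IHk]; first by rewrite !big_geq.
  rewrite !big_nat_recr //= IHk.
  have -> : ((0 +i* x)%C : complexC R) = x%:C%C * 'i%C by simpc.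
  rewrite exprMn imaginary_power -rmorphXn -(rmorph_nat (real_complex R)) -fmorphV.
  rewrite mulrA -rmorphM /=; simpc; apply/eqP; rewrite eq_complex /=.
  by apply/andP; split; apply/eqP; congr (_ + _);
    rewrite /cos_coeff /sin_coeff /= -?exprnP mulrC -mulrA [_^-1 * _]mulrC mulrA.
apply: cvg_complex; rewrite unlock.
  exact: is_cvg_series_cos_coeff.
exact: is_cvg_series_sin_coeff.
Qed.

Lemma unitary_evolution_diag (n : nat) (N : 'M[R]_n) (V : 'M[complexC R]_n)
    (l : 'I_n -> R) (t : R) :
  V \in unitmx ->
  map_mx (real_complex R) N = invmx V *m diag_mx (\row_i (l i)%:C%C) *m V ->
  unitary_evolution N t = invmx V *m diag_mx (\row_i cis (t * l i)) *m V.
Proof.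
move=> Vu NE; rewrite /unitary_evolution NE scalemxAl scalemxAr -linearZ.
apply: expmx_conj_diag => // i; rewrite !mxE.
have -> : (0 +i* t)%C * (l i)%:C%C = (0 +i* (t * l i))%C :> complexC R by simpc.
exact: series_cis.
Qed.

End UnitaryEvolution.

Lemma mul_diag_mx_dist (C : numDomainType) (n : nat) (A B : 'M[C]_n)
    (y z : 'rV[C]_n) (i j : 'I_n) :
  `|(A *m diag_mx y *m B) i j - (A *m diag_mx z *m B) i j| <=
  \sum_k `|A i k * B k j| * `|y 0 k - z 0 k|.
Proof.
have entry x : (A *m diag_mx x *m B) i j = \sum_k (A i k * B k j) * x 0 k.
  by rewrite mxE; apply: eq_bigr => k _; rewrite mul_mx_diag mxE mulrAC.
rewrite !entry -sumrB; apply: le_trans (ler_norm_sum _ _ _) _.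
by apply: ler_sum => k _; rewrite -mulrBr normrM.
Qed.

Section EvolutionClosure.
Variable R : realType.
Local Open Scope classical_set_scope.

Lemma sqr_normc_cisB (a b : R) :
  `|cis a - cis b| ^+ 2 = (2 - 2 * cos (a - b))%:C%C :> complexC R.
Proof.
rewrite normc_def -rmorphXn sqr_sqrtr ?addr_ge0 ?sqr_ge0 //=; congr (_%:C)%C.
rewrite cosB; have := cos2Dsin2 a; have := cos2Dsin2 b.
move: (cos a) (cos b) (sin a) (sin b) => ca cb sa sb h1 h2.
rewrite !sqrrB; lra.
Qed.

(** Kronecker's theorem at the level of matrices: the matrices with the eigenvectors
of [N] are close when their eigenvalues are. *)
Lemma closure_unitary_evolution (X : finType) (K : {set X}) (N : 'M[R]_#|X|)
    (V : 'M[complexC R]_#|X|) (l th : 'I_#|X| -> R) :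
  V \in unitmx ->
  map_mx (real_complex R) N = invmx V *m diag_mx (\row_i (l i)%:C%C) *m V ->
  (forall m : 'I_#|X| -> int, \sum_i (m i)%:~R * l i = 0 ->
     \sum_i (m i)%:~R * th i = 0) ->
  closure [set principal_submx K (unitary_evolution N t)
          | t in [set t : R | 0 <= t]]
    (principal_submx K (invmx V *m diag_mx (\row_i cis (th i)) *m V)).
Proof.
move=> Vu NE rel B /nbhs_ballP[e /= e0 eB].
have [d d0 Ee] : exists2 d : R, 0 < d & e = d%:C%C.
  exists (complex.Re e); first by move: e0; rewrite ltcE => /andP[].
  by rewrite RRe_real // gtr0_real.
pose c i j k : R := complex.Re `|invmx V i k * V k j|.
have cE i j k : `|invmx V i k * V k j| = (c i j k)%:C%C by rewrite RRe_real // normr_real.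
have c0 i j k : 0 <= c i j k by rewrite -ler0c -cE normr_ge0.
pose M := 1 + \sum_i \sum_j \sum_k c i j k.
have sum0 i j : 0 <= \sum_k c i j k by rewrite sumr_ge0.
have M0 : 0 < M by rewrite ltr_pwDl // sumr_ge0 // => i _; rewrite sumr_ge0.
have cM i j : \sum_k c i j k < M.
  apply: (@le_lt_trans _ _ (\sum_j \sum_k c i j k)).
    by rewrite [leRHS](bigD1 j) //= lerDl sumr_ge0.
  rewrite /M [X in _ < _ + X](bigD1 i) //= addrCA ltrDl ltr_pwDl // sumr_ge0 // => i' _.
  by rewrite sumr_ge0.
have eps0 : 0 < (d / M) ^+ 2 / 2 by rewrite divr_gt0 // exprn_gt0 // divr_gt0.
have [t t0 close] := kronecker rel eps0.
exists (principal_submx K (unitary_evolution N t)); split; first by exists t.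
apply: eB; split => // i j.
have subE (A : 'M[complexC R]_#|X|) :
    principal_submx K A i j = A (enum_rank (enum_val i)) (enum_rank (enum_val j)).
  by rewrite mxE.
rewrite !subE.
rewrite (unitary_evolution_diag t Vu NE).
move: (enum_rank (enum_val i)) (enum_rank (enum_val j)) => a b.
rewrite -ball_normE /ball_ /=.
apply: le_lt_trans (mul_diag_mx_dist _ _ _ _ _ _) _.
apply: (@le_lt_trans _ _ (\sum_k c a b k * (d / M))%:C%C).
  rewrite rmorph_sum; apply: ler_sum => k _; rewrite !mxE cE rmorphM.
  apply: ler_wpM2l; first by rewrite ler0c.
  rewrite -ler_sqr ?nnegrE ?normr_ge0 ?ler0c ?divr_ge0 ?(ltW d0) ?(ltW M0) //.
  rewrite sqr_normc_cisB -rmorphXn lecR -cosN opprB.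
  by have := close k; lra.
rewrite Ee ltcR -mulr_suml mulrA ltr_pdivrMr // mulrC ltr_pM2l //.
Qed.

End EvolutionClosure.

(** * Simultaneous diagonalization and principal submatrices *)

Section SimultaneousDiagonalization.
Local Open Scope sesquilinear_scope.

(** [A], [B] and the adjoint of [B] commute, so a unitary matrix makes the three
triangular at once; for a triangular matrix whose adjoint is triangular on the
same side, this means diagonal. *)
Lemma codiagonalization_hermitian_normal (C : numClosedFieldType) (n : nat) (A B : 'M[C]_n) :
  A ^t* = A -> B *m B ^t* = B ^t* *m B -> A *m B = B *m A ->
  exists (V : 'M[C]_n) (a b : 'rV[C]_n), [/\ V \is unitarymx,
    A = invmx V *m diag_mx a *m V, B = invmx V *m diag_mx b *m V &
    forall i, a 0 i \is Num.real].
Proof.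
move=> A_herm B_norm AB.
have adj_mul (X Y : 'M[C]_n) : (X *m Y) ^t* = Y ^t* *m X ^t* by rewrite trmx_mul map_mxM.
have ABs : A *m B ^t* = B ^t* *m A.
  by have := congr1 (fun X => X ^t*) AB; rewrite !adj_mul A_herm.
have [|V V_unit /and4P[trA trB trBs _]] := @cotrigonalization C n [:: A; B; B ^t*].
  by move=> X Y; rewrite !inE => /or3P[]/eqP-> /or3P[]/eqP->; rewrite /comm_mx.
have Vu := unitarymx_unit V_unit.
have conjE X : conjmx V X = V *m X *m V ^t* by rewrite conjumx // invmx_unitary.
have conj_adj X : (conjmx V X) ^t* = conjmx V (X ^t*).
  by rewrite !conjE !adj_mul trmxCK mulmxA.
have diag_of X : is_trig_mx (conjmx V X) -> is_trig_mx (conjmx V (X ^t*)) ->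
    X = invmx V *m diag_mx (\row_i conjmx V X i i) *m V.
  move=> /is_trig_mxP tX /is_trig_mxP tXs.
  have -> : diag_mx (\row_i conjmx V X i i) = conjmx V X.
    apply/matrixP => i j; rewrite [LHS]mxE [(\row_ _ _) _ _]mxE.
    case: (ltngtP i j) => [ij|ji|/val_inj->].
    - have /negPf -> : i != j by rewrite -val_eqE neq_ltn ij.
      by rewrite mulr0n tX.
    - have /negPf -> : i != j by rewrite -val_eqE neq_ltn ji orbT.
      rewrite mulr0n.
      have := tXs _ _ ji; rewrite -conj_adj mxE [_^T _ _]mxE => /eqP.
      by rewrite conjC_eq0 => /eqP->.
    - by rewrite eqxx.
  by rewrite conjumx // !mulmxA mulVmx // mul1mx mulmxKV.
exists V, (\row_i conjmx V A i i), (\row_i conjmx V B i i); split => //.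
- by apply: diag_of; rewrite ?A_herm.
- exact: diag_of.
move=> i; rewrite mxE; apply/CrealP.
by have := conj_adj A; rewrite A_herm => /matrixP/(_ i i); rewrite mxE [_^T _ _]mxE.
Qed.

End SimultaneousDiagonalization.

Section DiagonalCalculus.
Variables (F : fieldType) (n : nat) (V : 'M[F]_n).
Hypothesis Vu : V \in unitmx.
Local Notation conj_diag d := (invmx V *m diag_mx d *m V).

(** A matrix that commutes with [b] commutes with every function [c] of [b]. *)
Lemma comm_conj_diag (D : 'M[F]_n) (b c : 'rV[F]_n) :
  (forall i j, b 0 i = b 0 j -> c 0 i = c 0 j) ->
  D *m conj_diag b = conj_diag b *m D -> D *m conj_diag c = conj_diag c *m D.
Proof.
move=> bc Db; have [Y EY] : exists Y, Y = V *m D *m invmx V by exists (V *m D *m invmx V).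
have toY d : V *m (D *m conj_diag d) *m invmx V = Y *m diag_mx d.
  by rewrite EY !mulmxA mulmxK.
have toY2 d : V *m (conj_diag d *m D) *m invmx V = diag_mx d *m Y.
  by rewrite EY !mulmxA mulmxV // mul1mx.
have Yb : Y *m diag_mx b = diag_mx b *m Y by rewrite -toY -toY2 Db.
have Yc : Y *m diag_mx c = diag_mx c *m Y.
  apply/matrixP => i j; rewrite mul_mx_diag mul_diag_mx mxE [RHS]mxE mulrC.
  have /eqP : b 0 j * Y i j = b 0 i * Y i j.
    have := congr1 (fun A : 'M[F]_n => A i j) Yb.
    by rewrite mul_mx_diag mul_diag_mx !mxE mulrC.
  rewrite -subr_eq0 -mulrBl mulf_eq0 subr_eq0 => /orP[/eqP/bc->//|/eqP->].
  by rewrite !mulr0.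
have := congr1 (fun A => invmx V *m A *m V) Yc; rewrite /= -toY -toY2.
by rewrite !mulmxA mulVmx // !mul1mx -!mulmxA mulVmx // !mulmx1 !mulmxA.
Qed.

(** If [c] acts as a scalar on the image of [D] and determines [x], then [x] also acts
as a scalar there: the image of [D] lies in one eigenspace of [c]. *)
Lemma conj_diag_scalar_on (D : 'M[F]_n) (c x : 'rV[F]_n) (s : F) :
  (forall i j, c 0 i = c 0 j -> x 0 i = x 0 j) -> D != 0 ->
  conj_diag c *m D = s *: D -> exists x0, conj_diag x *m D = x0 *: D.
Proof.
move=> cx D0 cD; have [Y EY] : exists Y, Y = V *m D by exists (V *m D).
have DE : D = invmx V *m Y by rewrite EY mulKmx.
have cY i j : Y i j != 0 -> c 0 i = s.
  move=> Y0; have : diag_mx c *m Y = s *: Y.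
    by rewrite EY scalemxAr -cD !mulmxA mulmxV // mul1mx.
  move=> /(congr1 (fun A : 'M[F]_n => A i j)); rewrite mul_diag_mx !mxE.
  exact: mulIf.
have [i0 [j0 Y0]] : exists i j, Y i j != 0.
  apply: contra_neqP D0 => noY; rewrite DE (_ : Y = 0) ?mulmx0 //.
  apply/matrixP => i j; rewrite mxE; apply/eqP; apply: contra_notT noY => Yij.
  by exists i, j.
exists (x 0 i0); rewrite DE !mulmxA mulmxK // -mulmxA scalemxAr.
congr (_ *m _); apply/matrixP => i j; rewrite mul_diag_mx mxE [RHS]mxE.
have [->|Yij] := eqVneq (Y i j) 0; first by rewrite !mulr0.
by rewrite (cx i i0) // (cY _ _ Yij) (cY _ _ Y0).
Qed.

Lemma conj_diag_eigen (A : 'M[F]_n) (d : 'rV[F]_n) i :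
  A = conj_diag d -> row i V *m A = d 0 i *: row i V.
Proof.
move=> ->; rewrite -row_mul !mulmxA mulmxV // mul1mx.
by apply/rowP => j; rewrite !mxE (bigD1 i) //= big1 ?addr0 => [|k ki];
  rewrite !mxE ?eqxx ?mulr1n // eq_sym (negPf ki) mul0r.
Qed.

Lemma conj_diag_inv (A B : 'M[F]_n) (d : 'rV[F]_n) :
  A = conj_diag d -> (forall i, d 0 i != 0) -> B *m A = 1%:M ->
  B = conj_diag (\row_i (d 0 i)^-1).
Proof.
move=> AE d0 BA; have AX : A *m conj_diag (\row_i (d 0 i)^-1) = 1%:M.
  rewrite AE !mulmxA mulmxK // -[_ *m diag_mx d *m _]mulmxA mulmx_diag.
  rewrite (_ : diag_mx _ = 1%:M) ?mulmx1 ?mulVmx //.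
  by rewrite -diag_const_mx; congr diag_mx; apply/rowP => i; rewrite !mxE mulfV.
by rewrite -[LHS]mulmx1 -AX mulmxA BA mul1mx.
Qed.

Lemma conj_diagD (a b : 'rV[F]_n) : conj_diag a + conj_diag b = conj_diag (a + b).
Proof. by rewrite -mulmxDl -mulmxDr -raddfD. Qed.
End DiagonalCalculus.

Section PrincipalSubmatrix.
Variables (C : numClosedFieldType) (X : finType) (K : {set X}).
Local Notation D := (indic_diag_mx C K).

Lemma indic_diag_mxE x y : D (enum_rank x) (enum_rank y) = ((x == y) && (x \in K))%:R.
Proof.
rewrite !mxE enum_rankK (inj_eq enum_rank_inj).
by case: (x == y); rewrite ?mulr1n.
Qed.

Lemma principal_submx_comm0 (W : 'M[C]_#|X|) x y :
  W *m D = D *m W -> x \in K -> y \notin K -> W (enum_rank x) (enum_rank y) = 0.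
Proof.
move=> WD xK yK; have := congr1 (fun A : 'M[C]_#|X| => A (enum_rank x) (enum_rank y)) WD.
rewrite mul_mx_diag mul_diag_mx !mxE !enum_rankK xK (negPf yK) mulr0 mul1r.
by [].
Qed.

(** Commutation with the projection makes [W] block diagonal. *)
Lemma principal_submx_unitary (W : 'M[C]_#|X|) :
  W *m D = D *m W -> W \is unitarymx -> principal_submx K W \is unitarymx.
Proof.
move=> WD /unitarymxP WW; apply/unitarymxP/matrixP => i j.
have := congr1 (fun A : 'M[C]_#|X| => A (enum_rank (enum_val i)) (enum_rank (enum_val j))) WW.
rewrite !mxE (inj_eq enum_rank_inj) (inj_eq enum_val_inj) => <-.
rewrite (reindex (@enum_rank X)) /=; last exact/onW_bij/enum_rank_bij.
rewrite (bigID (mem K)) /= [X in _ + X]big1 ?addr0 => [|x xK]; last first.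
  by rewrite (principal_submx_comm0 WD (enum_valP i) xK) mul0r.
rewrite [RHS]big_enum_val; apply: eq_bigr => k _.
by rewrite !mxE.
Qed.

Lemma principal_submx_scalar (W : 'M[C]_#|X|) :
  W *m D = D *m W -> is_scalar_mx (principal_submx K W) ->
  exists s, W *m D = s *: D.
Proof.
move=> WD /is_scalar_mxP[s Ws]; exists s; apply/matrixP => i j.
rewrite -(enum_valK i) -(enum_valK j); move: (enum_val i) (enum_val j) => x y.
rewrite mul_mx_diag mxE [RHS]mxE indic_diag_mxE mxE enum_rankK.
have [yK|yK] := boolP (y \in K); last first.
  by rewrite mulr0; case: eqP => [->|_]; rewrite ?(negPf yK) mulr0.
have [xK|xK] := boolP (x \in K); last first.
  rewrite andbF mulr0.
  have := congr1 (fun A : 'M[C]_#|X| => A (enum_rank x) (enum_rank y)) WD.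
  by rewrite mul_mx_diag mul_diag_mx !mxE !enum_rankK yK (negPf xK) mul0r.
have := congr1 (fun A : 'M[C]_#|K| => A (enum_rank_in xK x) (enum_rank_in yK y)) Ws.
rewrite !mxE !enum_rankK_in // mulr1 andbT => ->.
by rewrite -(inj_eq enum_val_inj) !enum_rankK_in // mulr_natr.
Qed.
End PrincipalSubmatrix.

(** * The joint spectrum of the rotation and the weighted graph *)

(** The characteristic equation with the weight [Q] in the first, second or third
diagonal entry, written as a linear equation in [Q]. *)
Lemma pencil_char_eq (R : comNzRingType) (l x Q : R) :
  [/\ (l - x - Q) * l * l - (l - x - Q) - l - (2 + x) * l - (2 + x) = 0 ->
        (pencil_cubic x).[l] = Q * (pencil_quadratic 0 1).[l],
      (l - x) * (l - Q) * l - (l - x) - (l - Q) - (2 + x) * l - (2 + x) = 0 ->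
        (pencil_cubic x).[l] = Q * (pencil_quadratic x 1).[l] &
      (l - x) * l * (l - Q) - (l - x) - l - (2 + x) * (l - Q) - (2 + x) = 0 ->
        (pencil_cubic x).[l] = Q * (pencil_quadratic x (2 + x)).[l]].
Proof.
rewrite /pencil_cubic /pencil_quadratic 
  !(hornerD, hornerN, hornerM, hornerC, hornerXn, hornerX).
by split=> ce; apply/eqP; rewrite -subr_eq0 -[X in _ == X]ce; apply/eqP; ring.
Qed.

(** The three equations form a linear system of determinant [D] with a nonzero
solution; each product of [D] with an unknown is the combination of the
equations given by a row of the adjugate matrix. *)
Lemma block_char_eq (C : fieldType) (a w w' qa qb qc al be ga : C) :
  w * w' = 1 ->
  a * al = (w + w' + qa) * al + (1 + w) * be + ga ->
  a * be = (1 + w') * al + qb * be + ga ->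
  a * ga = al + be + qc * ga ->
  [|| al != 0, be != 0 | ga != 0] ->
  let x := w + w' in
  (a - x - qa) * (a - qb) * (a - qc) - (a - x - qa) - (a - qb)
    - (2 + x) * (a - qc) - (2 + x) = 0.
Proof.
move=> ww' ea eb ec nz x.
set X := a - x - qa; set Y := a - qb; set Z := a - qc.
have E1 : X * al - (1 + w) * be - ga = 0 by rewrite /X mulrBl mulrBl ea /x; ring.
have E2 : - (1 + w') * al + Y * be - ga = 0 by rewrite /Y mulrBl eb; ring.
have E3 : - al - be + Z * ga = 0 by rewrite /Z mulrBl ec; ring.
have e : (1 + w) * (1 + w') = 2 + x by rewrite /x mulrDl mul1r mulrDr ww'; ring.
pose D := X * Y * Z - X - Y - (1 + w) * (1 + w') * Z - (1 + w) - (1 + w').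
have -> : X * Y * Z - X - Y - (2 + x) * Z - (2 + x) = D by rewrite /D e /x; ring.
have D_al : D * al = 0.
  have -> : D * al = (Y * Z - 1) * (X * al - (1 + w) * be - ga) +
      ((1 + w) * Z + 1) * (- (1 + w') * al + Y * be - ga) +
      (1 + w + Y) * (- al - be + Z * ga).
    by rewrite /D; ring.
  by rewrite E1 E2 E3 !mulr0 !addr0.
have D_be : D * be = 0.
  have -> : D * be = ((1 + w') * Z + 1) * (X * al - (1 + w) * be - ga) +
      (X * Z - 1) * (- (1 + w') * al + Y * be - ga) +
      (X + 1 + w') * (- al - be + Z * ga).
    by rewrite /D; ring.
  by rewrite E1 E2 E3 !mulr0 !addr0.
have D_ga : D * ga = 0.
  have -> : D * ga = (1 + w' + Y) * (X * al - (1 + w) * be - ga) +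
      (X + 1 + w) * (- (1 + w') * al + Y * be - ga) +
      (X * Y - (1 + w) * (1 + w')) * (- al - be + Z * ga).
    by rewrite /D; ring.
  by rewrite E1 E2 E3 !mulr0 !addr0.
have cancel z : D * z = 0 -> z != 0 -> D = 0.
  by move/eqP; rewrite mulf_eq0 => /orP[/eqP //|/eqP ->]; rewrite eqxx.
by case/or3P: nz; apply: cancel.
Qed.

Section RootsOfUnity.
Variable R : realType.

(** As [b] has modulus 1, its inverse is its conjugate. *)
Lemma root_of_unity_trace (r : nat) (b : complexC R) : (0 < r)%N -> b ^+ r = 1 ->
  let x := 2 * complex.Re b in
  [/\ b + b^-1 = x%:C%C, -2 <= x <= 2 & x \in @algebraic_pred R].
Proof.
move=> r0 br x.
have nb : `|b| = 1.
  by apply/eqP; rewrite -(@pexpr_eq1 _ _ r) // -normrX br normr1.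
have bV : b^-1 = (b^*)%C by rewrite invc_norm nb expr1n invr1 mul1r.
have xE : b + b^-1 = x%:C%C by rewrite bV addcJ /x rmorphM /= rmorph_nat.
split => //.
  have := normc_ge_Re b; rewrite nb lecR /x ler_norml => /andP[]; lra.
apply/asboolP.
have b_alg : algebraicOver (ratr : rat -> complexC R) b.
  exists ('X^r - 1); first by rewrite -size_poly_gt0 size_XnsubC.
  rewrite rmorphB rmorphXn /= map_polyX rmorph1 rootE.
  by rewrite hornerD hornerN horner_exp hornerX hornerC br subrr.
have [p p0 pb] := algebraic_add b_alg (algebraic_inv b_alg).
exists p => //; move: pb; rewrite xE.
have -> : map_poly ratr p = map_poly (real_complex R) (map_poly ratr p).
  by rewrite -map_poly_comp; apply: eq_map_poly => q /=; rewrite fmorph_rat.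
by rewrite fmorph_root.
Qed.
End RootsOfUnity.

Section Rotation.
Variable r : nat.

Definition rotate_vertex (x : Gr_vertex r) : Gr_vertex r :=
  match x with
  | inl (inl i) => va (ordS i)
  | inl (inr i) => vb (ordS i)
  | inr i => vc (ordS i)
  end.

Lemma ordS_inj : injective (@ordS r).
Proof. exact: can_inj (@ordSK r). Qed.

Lemma rotate_vertex_inj : injective rotate_vertex.
Proof.
pose inv x : Gr_vertex r := match x with
  | inl (inl i) => va (ord_pred i)
  | inl (inr i) => vb (ord_pred i)
  | inr i => vc (ord_pred i) end.
by apply: (@can_inj _ _ rotate_vertex inv) => -[[i|i]|i] /=; rewrite ordSK.
Qed.

Lemma Gr_edge_rotate_vertex x y : Gr_edge (rotate_vertex x) (rotate_vertex y) = Gr_edge x y.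
Proof.
by case: x y => [[i|i]|i] [[j|j]|j]; rewrite /Gr_edge /= ?(inj_eq ordS_inj).
Qed.

Lemma iter_rotate_vertex x : iter r rotate_vertex x = x.
Proof.
have iterS (i : 'I_r) k : (iter k (@ordS r) i : nat) = ((i + k) %% r)%N.
  elim: k => [|k IHk]; first by rewrite addn0 modn_small.
  by rewrite iterS /= IHk -addn1 modnDml addn1 addnS.
have iterSr (i : 'I_r) : iter r (@ordS r) i = i.
  by apply: val_inj; rewrite /= iterS modnDr modn_small.
have iter_va k (i : 'I_r) : iter k rotate_vertex (va i) = va (iter k (@ordS r) i).
  by elim: k => //= k ->.
have iter_vb k (i : 'I_r) : iter k rotate_vertex (vb i) = vb (iter k (@ordS r) i).
  by elim: k => //= k ->.
have iter_vc k (i : 'I_r) : iter k rotate_vertex (vc i) = vc (iter k (@ordS r) i).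
  by elim: k => //= k ->.
by case: x => [[i|i]|i]; [rewrite (iter_va r)|rewrite (iter_vb r)|rewrite (iter_vc r)];
  rewrite iterSr.
Qed.

Lemma ordS_neq (i : 'I_r) : (1 < r)%N -> ordS i != i.
Proof.
move=> r1; rewrite -val_eqE /=; have := ltn_ord i.
rewrite leq_eqVlt => /predU1P[ir|ir].
  by rewrite ir modnn; apply: contraTneq r1 => i0; rewrite -ir -i0.
by rewrite modn_small // gtn_eqF.
Qed.

(** This is where the cycle must have length at least 3: otherwise [a_(i-1)] and
[a_(i+1)] coincide. *)
Lemma ordSS_neq (i : 'I_r) : (2 < r)%N -> ordS (ordS i) != i.
Proof.
move=> r2; rewrite -val_eqE /= -addn1 modnDml addn1; have := ltn_ord i.
rewrite leq_eqVlt => /predU1P[ir|ir].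
  have -> : i.+2 = (1 + r)%N by rewrite add1n; congr S.
  by rewrite modnDr modn_small; lia.
move: ir; rewrite leq_eqVlt => /predU1P[ir|ir].
  by rewrite ir modnn; lia.
by rewrite modn_small // ; lia.
Qed.

Lemma rotate_vertex_neq x : (1 < r)%N -> rotate_vertex x != x.
Proof.
move=> r1; pose idx (y : Gr_vertex r) : 'I_r :=
  match y with inl (inl i) => i | inl (inr i) => i | inr i => i end.
apply: contra_neq (ordS_neq (idx x) r1) => rx; rewrite -[in RHS]rx.
by case: x {rx} => [[i|i]|i].
Qed.

Lemma orbit_indicator (K : {set Gr_vertex r}) :
  K = orbit_a r \/ K = orbit_b r \/ K = orbit_c r ->
  exists ka kb kc : bool,
  [/\ forall i, (va i \in K) = ka, forall i, (vb i \in K) = kb,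
      forall i, (vc i \in K) = kc &
      (ka, kb, kc) \in [:: (true, false, false); (false, true, false); (false, false, true)]].
Proof.
case=> [->|[->|->]]; [exists true, false, false | exists false, true, false |
  exists false, false, true]; split => //= i; first [exact: imset_f|by apply/imsetP => -[]].
Qed.

End Rotation.

Section RotationMatrix.
Variables (R : realType) (r : nat).
Local Notation X := (Gr_vertex r).
Local Notation C := (complexC R).
Local Open Scope sesquilinear_scope.

Definition rot_mx : 'M[C]_#|X| :=
  \matrix_(i, j) (enum_val j == rotate_vertex (enum_val i))%:R.

Lemma sum_enum_rank (F : 'I_#|X| -> C) : \sum_i F i = \sum_x F (enum_rank x).
Proof. by rewrite (reindex (@enum_rank X)) //; exact/onW_bij/enum_rank_bij. Qed.

Lemma mul_rot_mx n (A : 'M[C]_(#|X|, n)) x j :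
  (rot_mx *m A) (enum_rank x) j = A (enum_rank (rotate_vertex x)) j.
Proof.
rewrite mxE sum_enum_rank (bigD1 (rotate_vertex x)) //= big1 ?addr0 => [|y yx].
  by rewrite mxE !enum_rankK eqxx mul1r.
by rewrite mxE !enum_rankK (negPf yx) mul0r.
Qed.

Lemma mul_tr_rot_mx n (A : 'M[C]_(n, #|X|)) i x :
  (A *m rot_mx^T) i (enum_rank x) = A i (enum_rank (rotate_vertex x)).
Proof. by rewrite -[in LHS](trmxK A) -trmx_mul mxE mul_rot_mx mxE. Qed.

Lemma rot_mx_adj : rot_mx ^t* = rot_mx^T.
Proof. by apply/matrixP => i j; rewrite !mxE conjC_nat. Qed.

Lemma mx_rankP (A B : 'M[C]_#|X|) :
  (forall x y, A (enum_rank x) (enum_rank y) = B (enum_rank x) (enum_rank y)) -> A = B.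
Proof. by move=> AB; apply/matrixP => i j; rewrite -(enum_valK i) -(enum_valK j) AB. Qed.

Lemma rot_mxM : rot_mx *m rot_mx^T = 1%:M.
Proof.
apply: mx_rankP => x y; rewrite mul_tr_rot_mx !mxE !enum_rankK.
by rewrite (inj_eq (@rotate_vertex_inj r)) (inj_eq enum_rank_inj) eq_sym.
Qed.

Lemma comm_rot_mx (A : 'M[C]_#|X|) :
  (forall x y, A (enum_rank (rotate_vertex x)) (enum_rank (rotate_vertex y)) =
               A (enum_rank x) (enum_rank y)) ->
  A *m rot_mx = rot_mx *m A.
Proof.
move=> A_rot; have AE : A = rot_mx *m A *m rot_mx^T.
  by apply: mx_rankP => x y; rewrite mul_tr_rot_mx mul_rot_mx A_rot.
by rewrite {1}AE -mulmxA (mulmx1C rot_mxM) mulmx1.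
Qed.

Lemma rot_eigenvector (v : 'rV[C]_#|X|) (b : C) x :
  v *m rot_mx = b *: v -> v 0 (enum_rank x) = b * v 0 (enum_rank (rotate_vertex x)).
Proof.
move=> vb; have := congr1 (fun u : 'rV_#|X| => (u *m rot_mx^T) 0 (enum_rank x)) vb.
by rewrite -mulmxA rot_mxM mulmx1 -scalemxAl mxE mul_tr_rot_mx.
Qed.

End RotationMatrix.

Section Spectrum.
Variables (R : realType) (r : nat) (Q : R).
Hypothesis r_ge3 : (3 <= r)%N.
Local Notation X := (Gr_vertex r).
Local Notation C := (complexC R).
Variables (K : {set X}) (ka kb kc : bool).
Hypotheses (Ka : forall i, (va i \in K) = ka) (Kb : forall i, (vb i \in K) = kb)
  (Kc : forall i, (vc i \in K) = kc).
Local Notation N :=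
  (map_mx (real_complex R) (graph_adjmx R (@Gr_edge r) + Q *: indic_diag_mx R K) : 'M[C]_#|X|).

Lemma weighted_adjmxE x y : N (enum_rank x) (enum_rank y) =
  (Gr_edge x y)%:R + Q%:C%C * ((x == y) && (y \in K))%:R.
Proof.
rewrite !mxE !enum_rankK rmorphD rmorphM /= rmorph_nat (inj_eq enum_rank_inj).
by case: eqP => [->|_]; rewrite ?mulr1n ?rmorph_nat // mulr0n rmorph0.
Qed.

Lemma mem_rotate_vertex x : (rotate_vertex x \in K) = (x \in K).
Proof. by case: x => [[i|i]|i] /=; rewrite ?Ka ?Kb ?Kc. Qed.

Lemma weighted_adjmx_comm_rot : N *m rot_mx R r = rot_mx R r *m N.
Proof.
apply: comm_rot_mx => x y.
by rewrite !weighted_adjmxE Gr_edge_rotate_vertex (inj_eq (@rotate_vertex_inj r))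
  mem_rotate_vertex.
Qed.

(** On an eigenvector of the rotation, the neighbours in a given orbit of a vertex
carry multiples by [w] or [w^-1] of the value at the vertex of index [j], so the
eigenvalue equation only involves the three vertices of index [j]. *)
Lemma weighted_adjmx_eigen_eq (v : 'rV[C]_#|X|) (a w : C) (j : 'I_r)
    (f := fun x : X => v 0 (enum_rank x) : C) :
  v *m N = a *: v -> v *m rot_mx R r = w *: v -> w != 0 ->
  [/\ a * f (va j) = (w + w^-1 + Q%:C%C * ka%:R) * f (va j) + (1 + w) * f (vb j) + f (vc j),
      a * f (vb j) = (1 + w^-1) * f (va j) + Q%:C%C * kb%:R * f (vb j) + f (vc j) &
      a * f (vc j) = f (va j) + f (vb j) + Q%:C%C * kc%:R * f (vc j)].
Proof.
move=> va_eq vw w0.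
have f_rot x : f (rotate_vertex x) = w^-1 * f x by rewrite /f (rot_eigenvector x vw) mulKf.
have f_next (s : 'I_r -> X) : (forall i, rotate_vertex (s i) = s (ordS i)) ->
    forall i, f (s (ordS i)) = w^-1 * f (s i).
  by move=> sr i; rewrite -sr f_rot.
have f_prev (s : 'I_r -> X) : (forall i, rotate_vertex (s i) = s (ordS i)) ->
    forall i, f (s (ord_pred i)) = w * f (s i).
  by move=> sr i; rewrite -{2}(ord_predK i) f_next // mulrA mulfV // mul1r.
have eig y : a * f y = \sum_x f x * (Gr_edge x y)%:R + Q%:C%C * (y \in K)%:R * f y.
  have := congr1 (fun u : 'rV_#|X| => u 0 (enum_rank y)) va_eq.
  rewrite !mxE => <-; rewrite sum_enum_rank.
  under eq_bigr do rewrite weighted_adjmxE mulrDr.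
  rewrite big_split /=; congr (_ + _); rewrite (bigD1 y) //= big1 => [|x xy].
    by rewrite eqxx addr0 mulrC.
  by rewrite (negPf xy) !mulr0.
have pick (F : 'I_r -> C) (i : 'I_r) : \sum_k F k * (k == i)%:R = F i.
  by rewrite (bigD1 i) //= eqxx mulr1 big1 ?addr0 // => k /negPf ->; rewrite mulr0.
have pickS (F : 'I_r -> C) (i : 'I_r) : \sum_k F k * (i == ordS k)%:R = F (ord_pred i).
  rewrite -[RHS]pick; apply: eq_bigr => k _; congr (_ * _%:R).
  by rewrite -{1}(ord_predK i) (inj_eq (@ordS_inj r)) eq_sym.
have pickC (F : 'I_r -> C) (i : 'I_r) : \sum_k F k * (i == k)%:R = F i.
  by rewrite -[RHS]pick; apply: eq_bigr => k _; rewrite eq_sym.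
have disj (p q : bool) : ~~ (p && q) -> (p || q)%:R = p%:R + q%:R :> C.
  by case: p; case: q => //= _; rewrite ?addr0 ?add0r.
have sumE (F : X -> C) : \sum_x F x =
    \sum_i F (va i) + \sum_i F (vb i) + \sum_i F (vc i).
  by rewrite !big_sumType.
have r_gt1 : (1 < r)%N by apply: leq_trans r_ge3.
split; rewrite eig ?Ka ?Kb ?Kc sumE.
- have aa k : (Gr_edge (va k) (va j))%:R = (j == ordS k)%:R + (k == ordS j)%:R :> C.
    apply: disj; apply/negP => /andP[/eqP-> /eqP kk].
    by have := ordSS_neq k r_ge3; rewrite -kk eqxx.
  have ba k : (Gr_edge (vb k) (va j))%:R = (j == k)%:R + (j == ordS k)%:R :> C.
    rewrite /Gr_edge /= orbF; apply: disj; apply/negP => /andP[/eqP-> /eqP kk].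
    by have := ordS_neq k r_gt1; rewrite -kk eqxx.
  have ca k : (Gr_edge (vc k) (va j))%:R = (j == k)%:R :> C.
    by rewrite /Gr_edge /= orbF.
  under eq_bigr do rewrite aa mulrDr; rewrite big_split /= pickS pick.
  under [X in _ + X + _ + _]eq_bigr do rewrite ba mulrDr.
  rewrite big_split /= pickS pickC.
  under [X in _ + _ + X + _]eq_bigr do rewrite ca.
  rewrite pickC (f_next (@va r)) // (f_prev (@va r)) // (f_prev (@vb r)) //; ring.
- have ab k : (Gr_edge (va k) (vb j))%:R = (k == j)%:R + (k == ordS j)%:R :> C.
    rewrite /Gr_edge /=; apply: disj; apply/negP => /andP[/eqP-> /eqP kk].
    by have := ordS_neq j r_gt1; rewrite -kk eqxx.
  have cb k : (Gr_edge (vc k) (vb j))%:R = (j == k)%:R :> C.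
    by rewrite /Gr_edge /= orbF.
  under eq_bigr do rewrite ab mulrDr; rewrite big_split /= !pick.
  rewrite [X in _ + X + _ + _]big1 => [|k _]; last exact: mulr0.
  under [X in _ + _ + X + _]eq_bigr do rewrite cb.
  by rewrite pickC (f_next (@va r)) //; ring.
have ac k : (Gr_edge (va k) (vc j))%:R = (k == j)%:R :> C by [].
have bc k : (Gr_edge (vb k) (vc j))%:R = (k == j)%:R :> C by [].
under eq_bigr do rewrite ac; rewrite pick.
under [X in _ + X + _ + _]eq_bigr do rewrite bc; rewrite pick.
rewrite [X in _ + _ + X + _]big1 ?addr0 // => k _; exact: mulr0.
Qed.

End Spectrum.

Section JointSpectrum.
Variables (R : realType) (r : nat) (Q : R).
Hypotheses (r_ge3 : (3 <= r)%N) (Q_tr : transcendental Q).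
Local Notation X := (Gr_vertex r).
Local Notation C := (complexC R).
Variable (K : {set X}).
Hypothesis K_orbit : K = orbit_a r \/ K = orbit_b r \/ K = orbit_c r.
Local Notation N :=
  (map_mx (real_complex R) (graph_adjmx R (@Gr_edge r) + Q *: indic_diag_mx R K) : 'M[C]_#|X|).
Local Open Scope sesquilinear_scope.

Lemma weighted_adjmx_hermitian : N ^t* = N.
Proof.
apply: mx_rankP => x y; rewrite mxE [_^T _ _]mxE !weighted_adjmxE.
rewrite rmorphD rmorphM /= !conjC_nat; congr (_ + _).
  by rewrite /Gr_edge orbC.
have -> : (Q%:C%C : C)^* = Q%:C%C by apply: conj_Creal; apply/complex_realP; exists Q.
by rewrite eq_sym; case: eqP => // ->.
Qed.

(** The joint spectrum: real eigenvalues [l] of the weighted adjacency matrix, with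
[x] the eigenvalues of the rotation plus its inverse, and the transfer of
integer relations from [l] to [x]. *)
Lemma weighted_adjmx_spectrum : exists (V : 'M[C]_#|X|) (l x : 'I_#|X| -> R) (w : 'rV[C]_#|X|),
  [/\ V \is unitarymx,
      N = invmx V *m diag_mx (\row_i (l i)%:C%C) *m V,
      rot_mx R r = invmx V *m diag_mx w *m V,
      forall i, w 0 i != 0 /\ w 0 i + (w 0 i)^-1 = (x i)%:C%C &
      forall i, -2 <= x i <= 2 /\ x i = 2 * complex.Re (w 0 i)] /\
  forall m : 'I_#|X| -> int, \sum_i (m i)%:~R * l i = 0 -> \sum_i (m i)%:~R * x i = 0.
Proof.
have [ka [kb [kc [Ka Kb Kc orb]]]] := orbit_indicator K_orbit.
move: orb; rewrite !inE => orb.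
have comm := weighted_adjmx_comm_rot Q Ka Kb Kc.
have P_norm : rot_mx R r *m rot_mx R r ^t* = rot_mx R r ^t* *m rot_mx R r.
  by rewrite rot_mx_adj rot_mxM (mulmx1C (rot_mxM R r)).
have [V [a [w [V_unit NE PE a_real]]]] :=
  codiagonalization_hermitian_normal weighted_adjmx_hermitian P_norm comm.
have Vu := unitarymx_unit V_unit.
pose l i := complex.Re (a 0 i); pose x i : R := 2 * complex.Re (w 0 i).
have aE i : a 0 i = (l i)%:C%C by rewrite RRe_real.
have eigN i : row i V *m N = a 0 i *: row i V.
  exact: (conj_diag_eigen Vu i NE).
have eigP i : row i V *m rot_mx R r = w 0 i *: row i V.
  exact: (conj_diag_eigen Vu i PE).
have vertexE i y : V i (enum_rank y) = w 0 i * V i (enum_rank (rotate_vertex y)).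
  by have := rot_eigenvector y (eigP i); rewrite !mxE.
have nz i : exists y, V i (enum_rank y) != 0.
  have : row i V != 0.
    apply: contraTneq isT => rV0; have /unitarymxP/matrixP/(_ i i) := V_unit.
    have -> : (V *m V ^t*) i i = row i (V *m V ^t*) 0 i by rewrite [RHS]mxE.
    rewrite row_mul rV0 mul0mx !mxE eqxx => /eqP.
    by rewrite eq_sym oner_eq0.
  apply: contra_neqP => noy; apply/rowP => j; rewrite !mxE -(enum_valK j).
  by apply/eqP; apply: contra_notT noy => yn; exists (enum_val j).
have w_pow i : w 0 i ^+ r = 1.
  have [y y0] := nz i; apply: (mulIf y0); rewrite mul1r.
  have powE k : V i (enum_rank y) = w 0 i ^+ k * V i (enum_rank (iter k (@rotate_vertex r) y)).
    elim: k => [|k IHk]; first by rewrite expr0 mul1r.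
    by rewrite IHk exprSr -mulrA iterS -vertexE.
  by rewrite [RHS](powE r) iter_rotate_vertex.
have r_gt0 : (0 < r)%N by apply: leq_trans r_ge3.
have w0 i : w 0 i != 0.
  by apply: contra_eq_neq (w_pow i) => ->; rewrite expr0n gtn_eqF // eq_sym oner_neq0.
have xP i := root_of_unity_trace r_gt0 (w_pow i).
pose qa : R := Q * ka%:R; pose qb : R := Q * kb%:R; pose qc : R := Q * kc%:R.
have char_eq i : (l i - x i - qa) * (l i - qb) * (l i - qc) - (l i - x i - qa)
   - (l i - qb) - (2 + x i) * (l i - qc) - (2 + x i) = 0.
  have [j tri] : exists j, [|| row i V 0 (enum_rank (va j)) != 0,
      row i V 0 (enum_rank (vb j)) != 0 | row i V 0 (enum_rank (vc j)) != 0].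
    have [y] := nz i; case: y => [[j|j]|j] Vy; exists j;
      by rewrite !mxE /va /vb /vc Vy ?orbT.
  have [e1 e2 e3] := weighted_adjmx_eigen_eq r_ge3 Ka Kb Kc j (eigN i) (eigP i) (w0 i).
  have [xE _ _] := xP i.
  have := block_char_eq (mulfV (w0 i)) e1 e2 e3 tri.
  rewrite /= xE -/(x i) aE => char_eqC; apply: complexI; rewrite -[RHS]char_eqC.
  rewrite /qa /qb /qc; move: (l i) (x i) => li xi.
  rewrite !(rmorphB, rmorphM, rmorphD) /= !rmorph_nat.
  by [].
pose u i : R := if ka then 0 else x i.
pose v i : R := if kc then 2 + x i else 1.
exists V, l, x, w; split.
  have aRow : a = \row_i (l i)%:C%C by apply/rowP => i; rewrite mxE -aE.
  split; [exact: V_unit | by rewrite -aRow; exact: NE | exact: PE | | ].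
  - by move=> i; have [] := xP i.
  by move=> i; have [] := xP i.
move=> m; apply: (pencil_eigenvalue_relation (u := u) (v := v) Q_tr).
- move=> i; have [_ _ x_alg] := xP i; rewrite /u /v; split => //.
    by case: (ka) => //; exact: rpred0.
  by case: (kc); rewrite ?rpred1 // rpredD // rpred_nat.
- move=> i; have [_ x_range _] := xP i; move: x_range; rewrite -/(x i) => x_range.
  have [rA rB rC] := pencil_resultant_neq0 x_range.
  by rewrite /u /v; case/or3P: orb => /eqP[-> _ ->].
move=> i; have := char_eq i; rewrite /u /v /qa /qb /qc.
have [hA hB hC] := pencil_char_eq (l i) (x i) Q.
by case/or3P: orb => /eqP[-> -> ->]; rewrite ?mulr0 ?mulr1 ?subr0 => ce;
  [apply: hA|apply: hB|apply: hC].
Qed.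

End JointSpectrum.

(** * Fractional revival *)

Theorem theorem4p8 (R : realType) (r : nat) (hr : (3 <= r)%N)
    (K : {set Gr_vertex r})
    (hK : K = orbit_a r \/ K = orbit_b r \/ K = orbit_c r)
    (Q : R) (hQ : transcendental Q) :
  pretty_good_fractional_revival
    (graph_adjmx R (@Gr_edge r) + Q *: indic_diag_mx R K) K.
Proof.
have [V [l [x [w [[V_unit NE PE wP xP] rel]]]]] := weighted_adjmx_spectrum hr hQ hK.
have Vu := unitarymx_unit V_unit.
have [ka [kb [kc [Ka Kb Kc _]]]] := orbit_indicator hK.
pose D := indic_diag_mx (complexC R) K.
pose phase : 'rV[complexC R]_#|Gr_vertex r| := \row_i cis (x i / 2).
pose W := invmx V *m diag_mx phase *m V.
have P_inv : (rot_mx R r)^T = invmx V *m diag_mx (\row_i (w 0 i)^-1) *m V.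
  by apply: (conj_diag_inv Vu PE _ (mulmx1C (rot_mxM R r))) => i; case: (wP i).
have SE : rot_mx R r + (rot_mx R r)^T = invmx V *m diag_mx (\row_i (x i)%:C%C) *m V.
  rewrite P_inv PE conj_diagD; congr (_ *m diag_mx _ *m _).
  by apply/rowP => i; rewrite !mxE; case: (wP i).
have PD : D *m rot_mx R r = rot_mx R r *m D.
  apply: comm_rot_mx => y z.
  by rewrite !indic_diag_mxE (inj_eq (@rotate_vertex_inj r)) (mem_rotate_vertex Ka Kb Kc).
have WD : W *m D = D *m W.
  apply/esym/(comm_conj_diag Vu (b := w)); last by rewrite -PE.
  move=> i j wij; rewrite !mxE; congr cis.
  by have [_ ->] := xP i; have [_ ->] := xP j; rewrite wij.
have phase_unit : diag_mx phase \is unitarymx.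
  apply/unitarymxP; rewrite tr_diag_mx map_diag_mx mulmx_diag -diag_const_mx.
  congr diag_mx; apply/rowP => i; rewrite !mxE.
  by rewrite -normCK normc_cis expr1n.
have W_unit : W \is unitarymx.
  apply: (mul_unitarymx _ V_unit); apply: (mul_unitarymx _ phase_unit).
  by rewrite (invmx_unitary V_unit) (trmxC_unitary V).
exists (principal_submx K W); split.
- apply: closure_unitary_evolution Vu NE _ => m /rel mx0.
  under eq_bigr do rewrite mulrA; by rewrite -mulr_suml mx0 mul0r.
- exact: (principal_submx_unitary WD W_unit).
apply/negP => /(principal_submx_scalar WD)[s WDs].
have [y yK] : exists y, y \in K.
  have i : 'I_r by apply: (@Ordinal r 0); apply: leq_trans hr.
  by case: (hK) => [->|[->|->]]; [exists (va i)|exists (vb i)|exists (vc i)];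
    exact: imset_f.
have D0 : D != 0.
  apply/eqP => /matrixP/(_ (enum_rank y) (enum_rank y))/eqP.
  by rewrite indic_diag_mxE mxE eqxx yK oner_eq0.
have phase_inj i j : phase 0 i = phase 0 j ->
    (\row_i (x i)%:C%C : 'rV[complexC R]_#|Gr_vertex r|) 0 i = (\row_i (x i)%:C%C) 0 j.
  rewrite !mxE => /cis_half_inj -> //; first by case: (xP i).
  by case: (xP j).
(* The sum of the rotation and its inverse would be scalar on [K], but its entry
   at a vertex [y] of [K] and the rotated vertex is nonzero. *)
have [x0] := conj_diag_scalar_on Vu phase_inj D0 WDs.
rewrite -SE => /matrixP/(_ (enum_rank (rotate_vertex y)) (enum_rank y)).
rewrite mul_mx_diag mxE [RHS]mxE indic_diag_mxE (negPf (rotate_vertex_neq _ _)) ?mulr0; last first.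
  by apply: leq_trans hr.
rewrite !mxE !enum_rankK yK mulr1 eqxx => /eqP.
by rewrite -natrD pnatr_eq0 addn1.
Qed.
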